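(* Let $\alpha,\theta$ be nonconstant inner functions such that $\alpha$ divides $\theta$, and let $A\in\mathcal{T}(\theta,\alpha)$. Suppose that a certain value is prescribed for either $\psi(0)$ or $\chi(0)$, and let $a,b,c\in\mathbb C$ be the corresponding solution (that is, the one with $a=\psi(0)$ if $\psi(0)$ is prescribed, respectively with $c=\overline{\chi(0)}$ if $\chi(0)$ is prescribed) of the linear system $$\begin{cases} a+\overline{\theta(0)}\alpha(0)\,b+\|k_0^\alpha\|^2\,c=\langle A k_0^\theta,k_0^\alpha\rangle,\\ \tfrac{\theta}{\alpha}(0)\,a+b=\langle A\tilde k_0^\theta,\tilde k_0^\alpha\rangle.\end{cases}$$ If $X,Y,Z$ satisfy the linear system (of functions) $$\begin{cases} X-\overline{\theta(0)}\,Y=A k_0^\theta-c\,k_0^\alpha-b\,\overline{\theta(0)}\,\alpha,\\ -\theta(0)\,X+Y=z\,A\tilde k_0^\theta-\tfrac{\theta}{\alpha}(0)\,a\,\alpha,\\ -\alpha(0)\tfrac{\theta}{\alpha}\,X+Y+(\alpha-\alpha(0))\,Z=z\,C_\theta A^*k_0^\alpha-a\,\theta,\end{cases}$$ then $A=A^{\theta,\alpha}_{\psi+\bar\chi}$, where $\psi=X$ and $\chi=\frac{\theta}{\alpha}\bar Z+\theta\bar Y$.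
   Context: $L^2=L^2(\mathbb T,m)$ with $\mathbb T$ the unit circle and $m$ normalized Lebesgue measure; $H^2\subset L^2$ is the Hardy space of the unit disc. For an inner function $u$, $K^2_u=H^2\ominus uH^2$, $P_u\colon L^2\to K^2_u$ is the orthogonal projection, $k_0^u=1-\overline{u(0)}\,u$, $\tilde k_0^u=\bar z(u-u(0))$ (both in $K_u^2$), and $C_u f=u\,\overline{z f}$ on $L^2$. $\alpha$ divides $\theta$ means that $\theta/\alpha=\bar\alpha\theta$ is inner. For $\varphi\in L^2$, $A_\varphi^{\theta,\alpha}f=P_\alpha(\varphi f)$ with domain $\{f\in K^2_\theta:\varphi f\in L^2\}$, which contains the dense subspace $K^2_\theta\cap H^\infty$; if it is bounded, $A_\varphi^{\theta,\alpha}$ also denotes its unique bounded extension $K^2_\theta\to K^2_\alpha$. $\mathcal T(\theta,\alpha)$ is the space of all bounded operators $K^2_\theta\to K^2_\alpha$ so obtained with $\varphi\in L^2$. Every $A\in\mathcal T(\theta,\alpha)$ has symbols of the form $\psi+\bar\chi$ with $\psi\in K^2_\alpha$, $\chi\in K^2_\theta$, unique up to replacing $(\psi,\chi)$ by $(\psi+c'k_0^\alpha,\chi-\overline{c'}k_0^\theta)$, $c'\in\mathbb C$, so one of the values $\psi(0)$, $\chi(0)$ can be prescribed arbitrarily. Equalities of functions are on $\mathbb T$ (a.e.). *)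

(* Defs.v *)
From HB Require Import structures.
From mathcomp Require Import all_boot all_order all_algebra.
From mathcomp Require Import complex.
From mathcomp Require Import all_classical all_reals all_analysis.

Set Implicit Arguments.
Unset Strict Implicit.
Unset Printing Implicit Defensive.
Import Order.TTheory GRing.Theory Num.Theory.
Import numFieldNormedType.Exports.

Local Open Scope classical_set_scope.
Local Open Scope complex_scope.
Local Open Scope ring_scope.

Record circle (R : realType) : Type := Circle {
  circle_val :> R[i];
  circle_norm : `|circle_val| = 1 }.

Section HardySpace.
Context {R : realType}.
Local Notation C := R[i].
Local Notation T := (circle R).
Local Notation mu := (@lebesgue_measure R).
Local Notation I := `[0 : R, 1 : R]%classic.
Implicit Types (f g u phi : T -> C) (K V W : set (T -> C)).

Lemma expi_norm (t : R) :
  `|cos (2 * pi * t) +i* sin (2 * pi * t)| = 1 :> C.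
Proof. by rewrite normc_def /= cos2Dsin2 sqrtr1. Qed.

Definition expi (t : R) : T := Circle (expi_norm t).

(* Normalized Lebesgue measure m on T is the image of Lebesgue measure on
   [0, 1] under expi, so measurability, integrals and equality a.e. on T are
   those of f \o expi on [0, 1]. Elements of L^2 are represented by functions,
   and statements about them are up to eqT. *)
Definition eqT f g : Prop := ae_eq mu I (f \o expi) (g \o expi).

Definition measurable_circle f : Prop :=
  measurable_fun I (fun t => complex.Re (f (expi t))) /\
  measurable_fun I (fun t => complex.Im (f (expi t))).

Definition intT f : C :=
  (\int[mu]_(t in I) complex.Re (f (expi t)))%R +i*
  (\int[mu]_(t in I) complex.Im (f (expi t)))%R.

Definition sqabs (w : C) : R := complex.Re w ^+ 2 + complex.Im w ^+ 2.

Definition L2 : set (T -> C) :=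
  [set f | measurable_circle f /\
           mu.-integrable I (fun t => (sqabs (f (expi t)))%:E)].

Definition L2norm f : R :=
  Num.sqrt (\int[mu]_(t in I) sqabs (f (expi t)))%R.

Definition inner f g : C := intT (fun z => f z * (g z)^*).

Definition fourier f (n : int) : C := intT (fun z => f z * (z : C) ^ (- n)).

Definition H2 : set (T -> C) :=
  [set f | L2 f /\ forall n : nat, fourier f (- (n.+1%:Z)) = 0].

(* The value at w, |w| < 1, of the analytic function in the disc whose
   boundary function is f, for f in H2 (Cauchy integral formula). *)
Definition disc_eval f (w : C) : C :=
  intT (fun z => f z / (1 - w * (z : C)^*)).

(* A unimodular function is bounded, so it is in H^oo iff it is in H2. *)
Definition is_inner u : Prop :=
  H2 u /\ eqT (fun z => `|u z|) (fun=> 1).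

Definition nonconstant u : Prop := ~ exists c : C, eqT u (fun=> c).

(* This is theta / alpha because alpha is unimodular a.e. on T. *)
Definition quo (theta alpha : T -> C) : T -> C :=
  fun z => (alpha z)^* * theta z.

Definition divides (alpha theta : T -> C) : Prop := is_inner (quo theta alpha).

Definition model (u : T -> C) : set (T -> C) :=
  [set f | H2 f /\ forall g, H2 g -> inner f (fun z => u z * g z) = 0].

(* g represents the orthogonal projection of f onto K. *)
Definition is_proj K f g : Prop :=
  K g /\ forall h, K h -> inner (fun z => f z - g z) h = 0.

Definition k0 u : T -> C := fun z => 1 - (disc_eval u 0)^* * u z.

Definition k0t u : T -> C := fun z => (z : C)^* * (u z - disc_eval u 0).

Definition conjugation u f : T -> C := fun z => u z * ((z : C) * f z)^*.

(* Linearity and boundedness make A compatible with eqT on V. *)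
Definition bounded_op V W (A : (T -> C) -> (T -> C)) : Prop :=
  [/\ forall f, V f -> W (A f),
      forall (c : C) f g, V f -> V g ->
        eqT (A (fun z => c * f z + g z)) (fun z => c * A f z + A g z) &
      exists M : R, forall f, V f -> L2norm (A f) <= M * L2norm f].

Definition is_adjoint V W (A B : (T -> C) -> (T -> C)) : Prop :=
  bounded_op W V B /\
  forall f g, V f -> W g -> inner (A f) g = inner f (B g).

(* A_phi^{theta,alpha} is bounded and A is its bounded extension to
   model theta; the extension is unique because the domain contains the bounded
   functions of model theta, which are dense. *)
Definition tto theta alpha phi (A : (T -> C) -> (T -> C)) : Prop :=
  [/\ L2 phi, bounded_op (model theta) (model alpha) A &
      forall f, model theta f -> L2 (fun z => phi z * f z) ->
        is_proj (model alpha) (fun z => phi z * f z) (A f)].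

Definition in_TTO theta alpha (A : (T -> C) -> (T -> C)) : Prop :=
  exists phi, tto theta alpha phi A.

End HardySpace.

(* Main.v *)
Require Import Defs.
From HB Require Import structures.
From mathcomp Require Import all_boot all_order all_algebra.
From mathcomp Require Import complex.
From mathcomp Require Import all_classical all_reals all_analysis.
From mathcomp Require Import measurable_realfun.
From mathcomp Require Import ring lra.

Set Implicit Arguments.
Unset Strict Implicit.
Unset Printing Implicit Defensive.
Import Order.TTheory GRing.Theory Num.Theory.
Import numFieldNormedType.Exports.

Local Open Scope classical_set_scope.
Local Open Scope complex_scope.
Local Open Scope ring_scope.

(** Why the theorem holds.  Write q = theta / alpha and choose a symbol
    psi0 + conj chi0 of A with psi0 in K_alpha and chi0 in K_theta, normalised
    so that psi0(0), or chi0(0), is the prescribed number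
    [symbol_normalised].  Split C_theta chi0 = h1 + alpha h2 along the
    orthogonal sum K_theta = K_alpha + alpha K_q [model_decomp], and put
    a0 = psi0(0), c0 = conj (chi0(0)) and b0 = conj ((C_alpha h1)(0)).
    Projecting the products of the symbol with the kernels gives closed
    formulas for A k_0, A k~_0 and C_theta A^* k_0 [tto_k0, tto_k0t,
    adjoint_k0].  These formulas say that (psi0, z h1, z h2) solves the system
    of functions written with (a0, b0, c0); paired with the kernels of K_alpha,
    the first two say that (a0, b0, c0) solves the scalar system [scalar_k0,
    scalar_k0t].  Both systems have at most one solution: their determinants
    are 1 - |alpha(0)|^2 and 1 - |theta(0)|^2, which do not vanish because
    alpha and theta are not constant [one_sub_norm_value], and alpha - alpha(0)
    vanishes almost nowhere because |alpha| = 1 > |alpha(0)|.  Hence X = psi0,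
    Y = z h1, Z = z h2, and
    q conj Z + theta conj Y = theta conj (z C_theta chi0) = chi0.

    Every projection onto K_u is computed in the same way.  A function f is in
    K_u exactly when f and its conjugate C_u f = u conj (z f) are in H2
    [modelP], and P_u f = g as soon as g is in K_u and
    f = g + u h + conj (z k) with h, k in H2 [is_proj_decomp].  Only algebra in
    H2 is left, together with |u| = 1.

    Two facts about L2 of the circle support this algebra.  Orthogonal
    projections onto closed subspaces exist [projection_exists], which rests on
    completeness [L2_complete].  A function whose Fourier coefficients all
    vanish is zero [fourier_null_eq0]; it follows that H2 is orthogonal to
    conj (z H2) [intT_analytic], hence that H2 is closed under the bounded
    products that occur.

    A last difficulty is that A is tied to a symbol phi only on the vectors f
    for which phi f is square integrable, a condition that changes with phi.
    Symbols are therefore compared on multipliers of L2 [weak_symbol].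
    The projections of the monomials z^n onto K_u are multipliers and no
    nonzero vector of K_u is orthogonal to all of them
    [model_multiplier_total]; the adjoint of A then carries the comparison from
    multipliers to all vectors without any approximation
    [tto_of_weak_symbol]. *)

(** * Integration, square integrability and multipliers on the circle *)

Section Integration.
Context {R : realType}.
Local Notation C := R[i].
Local Notation T := (circle R).
Local Notation mu := (@lebesgue_measure R).
Local Notation I := `[0 : R, 1 : R]%classic.
Local Notation Re := complex.Re.
Local Notation Im := complex.Im.
Implicit Types (f g h u : T -> C) (w : C).

Lemma Re_mul (w v : C) : Re (w * v) = Re w * Re v - Im w * Im v.
Proof. by case: w; case: v. Qed.
Lemma Im_mul (w v : C) : Im (w * v) = Re w * Im v + Im w * Re v.
Proof. by case: w; case: v. Qed.
Lemma Re_add (w v : C) : Re (w + v) = Re w + Re v.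
Proof. by case: w; case: v. Qed.
Lemma Im_add (w v : C) : Im (w + v) = Im w + Im v.
Proof. by case: w; case: v. Qed.
Lemma creal_conj w : Re w^* = Re w.
Proof. by case: w. Qed.
Lemma cimag_conj w : Im w^* = - Im w.
Proof. by case: w. Qed.

Lemma sqabs_ge0 w : 0 <= sqabs w.
Proof. by rewrite addr_ge0 ?sqr_ge0. Qed.
Lemma sqabsM (w v : C) : sqabs (w * v) = sqabs w * sqabs v.
Proof. rewrite /sqabs Re_mul Im_mul; ring. Qed.
Lemma sqabs_conj w : sqabs w^* = sqabs w.
Proof. by rewrite /sqabs creal_conj cimag_conj sqrrN. Qed.
Lemma sqabsD_le (w v : C) : sqabs (w + v) <= 2 * sqabs w + 2 * sqabs v.
Proof.
case: w v => a b [c d]; rewrite /sqabs /=.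
have := sqr_ge0 (a - c); have := sqr_ge0 (b - d); rewrite !expr2; lra.
Qed.
Lemma mul_conj_sqabs w : w * w^* = (sqabs w)%:C.
Proof.
by apply/eqP; rewrite eq_complex Re_mul Im_mul creal_conj cimag_conj /sqabs /=;
   apply/andP; split; apply/eqP; ring.
Qed.
Lemma sqabs_eq0 w : sqabs w = 0 -> w = 0.
Proof.
move/eqP; rewrite /sqabs paddr_eq0 ?sqr_ge0 // !sqrf_eq0 => /andP[/eqP a /eqP b].
by apply/eqP; rewrite eq_complex a b /= eqxx.
Qed.
Lemma sqabs_norm1 w : `|w| = 1 -> sqabs w = 1.
Proof.
move=> w1; have: w * w^* = 1 by rewrite -normCK w1 expr1n.
by rewrite mul_conj_sqabs => -[].
Qed.

Lemma measurable_itv01 : measurable (I : set (measurableTypeR R)). Proof. exact: measurable_itv. Qed.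
Hint Resolve measurable_itv01 : core.

(** The measurable structure found by inference when one quantifies over reals
    is not syntactically the one on which the measure is declared; without this
    instance the filter lemmas do not apply to almost everywhere statements. *)
#[export] Instance ae_real_filter :
  Filter (nbhs (almost_everywhere (mu : set R -> \bar R))).
Proof. exact: (@ae_filter_ringOfSetsType _ (measurableTypeR R) R mu). Qed.

Lemma Re_fun_mul f g : (fun t => Re (f (expi t) * g (expi t))) =
  (fun t => Re (f (expi t)) * Re (g (expi t)) - Im (f (expi t)) * Im (g (expi t))).
Proof. by apply/funext => t; rewrite Re_mul. Qed.
Lemma Im_fun_mul f g : (fun t => Im (f (expi t) * g (expi t))) =
  (fun t => Re (f (expi t)) * Im (g (expi t)) + Im (f (expi t)) * Re (g (expi t))).
Proof. by apply/funext => t; rewrite Im_mul. Qed.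
Lemma Re_fun_add f g : (fun t => Re (f (expi t) + g (expi t))) =
  (fun t => Re (f (expi t)) + Re (g (expi t))).
Proof. by apply/funext => t; rewrite Re_add. Qed.
Lemma Im_fun_add f g : (fun t => Im (f (expi t) + g (expi t))) =
  (fun t => Im (f (expi t)) + Im (g (expi t))).
Proof. by apply/funext => t; rewrite Im_add. Qed.
Lemma Re_fun_conj f : (fun t => Re (f (expi t))^*) = (fun t => Re (f (expi t))).
Proof. by apply/funext => t; rewrite creal_conj. Qed.
Lemma Im_fun_conj f : (fun t => Im (f (expi t))^*) = (fun t => - Im (f (expi t))).
Proof. by apply/funext => t; rewrite cimag_conj. Qed.

Lemma measurable_circleM f g : measurable_circle f -> measurable_circle g ->
  measurable_circle (fun z => f z * g z).
Proof.
move=> [a b] [c d]; split; rewrite ?Re_fun_mul ?Im_fun_mul.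
  by apply: measurable_funB; apply: measurable_funM.
by apply: measurable_funD; apply: measurable_funM.
Qed.
Lemma measurable_circleD f g : measurable_circle f -> measurable_circle g ->
  measurable_circle (fun z => f z + g z).
Proof.
by move=> [a b] [c d]; split; rewrite ?Re_fun_add ?Im_fun_add; apply: measurable_funD.
Qed.
Lemma measurable_circle_conj f : measurable_circle f -> measurable_circle (fun z => (f z)^*).
Proof.
by move=> [a b]; split; rewrite ?Re_fun_conj ?Im_fun_conj //; apply: measurable_funN.
Qed.
Lemma measurable_circle_cst w : measurable_circle (fun=> w).
Proof. by split; apply: measurable_cst. Qed.
Lemma measurable_circle_id : measurable_circle (fun z => z : C).
Proof.
split; apply: measurable_funTS; apply: continuous_measurable_fun => x.
  apply: (@continuous_comp _ _ _ (fun t : R => 2 * pi * t) cos).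
    exact: mulrl_continuous.
  exact: continuous_cos.
apply: (@continuous_comp _ _ _ (fun t : R => 2 * pi * t) sin).
  exact: mulrl_continuous.
exact: continuous_sin.
Qed.

Definition L1 f : Prop :=
  mu.-integrable I (EFin \o (fun t => Re (f (expi t)))) /\
  mu.-integrable I (EFin \o (fun t => Im (f (expi t)))).

Lemma L1_le f (F : R -> R) : measurable_circle f -> mu.-integrable I (EFin \o F) ->
  (forall t, `|Re (f (expi t))| <= F t) -> (forall t, `|Im (f (expi t))| <= F t) -> L1 f.
Proof.
move=> [a b] iF r i; split; apply: (le_integrable measurable_itv01 _ _ iF); try exact/measurable_EFinP;
by move=> t _; rewrite /= lee_fin; apply: le_trans (ler_norm _).
Qed.

Lemma integrable_add (F G : R -> R) : mu.-integrable I (EFin \o F) ->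
  mu.-integrable I (EFin \o G) -> mu.-integrable I (EFin \o (fun t => F t + G t)).
Proof. exact: (integrableD measurable_itv01). Qed.
Lemma integrable_scale (x : R) (F : R -> R) : mu.-integrable I (EFin \o F) ->
  mu.-integrable I (EFin \o (fun t => x * F t)).
Proof. exact: (integrableZl measurable_itv01). Qed.
Lemma integrable_opp (F : R -> R) : mu.-integrable I (EFin \o F) ->
  mu.-integrable I (EFin \o (fun t => - F t)).
Proof.
move=> /(integrable_scale (-1)); congr (mu.-integrable I (EFin \o _)).
by apply/funext => t; rewrite mulN1r.
Qed.
Lemma integrable_sub (F G : R -> R) : mu.-integrable I (EFin \o F) ->
  mu.-integrable I (EFin \o G) -> mu.-integrable I (EFin \o (fun t => F t - G t)).
Proof. by move=> iF /integrable_opp; apply: integrable_add. Qed.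

Lemma L1_scale w f : L1 f -> L1 (fun z => w * f z).
Proof.
move=> [a b]; split; rewrite ?(Re_fun_mul (fun=> w)) ?(Im_fun_mul (fun=> w)).
  by apply: integrable_sub; apply: integrable_scale.
by apply: integrable_add; apply: integrable_scale.
Qed.

Lemma intT_add f g : L1 f -> L1 g -> intT (fun z => f z + g z) = intT f + intT g.
Proof.
move=> [a b] [c d]; apply/eqP; rewrite eq_complex Re_add Im_add /=.
by apply/andP; split; apply/eqP; rewrite -RintegralD //;
   apply: eq_Rintegral => t _; rewrite ?Re_add ?Im_add.
Qed.
Lemma intT_scale w f : L1 f -> intT (fun z => w * f z) = w * intT f.
Proof.
move=> [a b]; apply/eqP; rewrite eq_complex Re_mul Im_mul /=; apply/andP; split; apply/eqP.
  under eq_Rintegral do rewrite Re_mul.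
  by rewrite RintegralB ?RintegralZl //;apply: integrable_scale.
under eq_Rintegral do rewrite Im_mul.
by rewrite RintegralD ?RintegralZl //; apply: integrable_scale.
Qed.
Lemma intT_conj f : L1 f -> intT (fun z => (f z)^*) = (intT f)^*.
Proof.
move=> [a b]; apply/eqP; rewrite eq_complex creal_conj cimag_conj /=; apply/andP; split; apply/eqP.
  by under eq_Rintegral do rewrite creal_conj.
under eq_Rintegral do rewrite cimag_conj -mulN1r.
by rewrite RintegralZl // mulN1r.
Qed.
Lemma intT_cst w : intT (fun=> w) = w.
Proof.
by case: w => a b; rewrite /intT /= !Rintegral_cst //= lebesgue_measure_itv /= lte01 oppr0 adde0 /= !mulr1.
Qed.

Lemma eqT_refl f : eqT f f. Proof. exact: ae_eq_refl. Qed.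
Lemma eqT_sym f g : eqT f g -> eqT g f. Proof. exact: ae_eq_sym. Qed.
(** This lemma and the next two turn almost everywhere identities into
    pointwise algebra: what follows at each point from identities that hold
    almost everywhere holds almost everywhere. *)
Lemma eqT1 a b f g : eqT a b -> (forall z, a z = b z -> f z = g z) -> eqT f g.
Proof. by rewrite /eqT /ae_eq => ab h; apply: filterS ab => t /= e It; apply: h; apply: e. Qed.
Lemma eqT2 a b a' b' f g : eqT a b -> eqT a' b' ->
  (forall z, a z = b z -> a' z = b' z -> f z = g z) -> eqT f g.
Proof.
rewrite /eqT /ae_eq => ab ab' h; apply: filterS2 ab ab' => t /= e e' It.
by apply: h; [apply: e | apply: e'].
Qed.
Lemma eqT3 a b a' b' a'' b'' f g : eqT a b -> eqT a' b' -> eqT a'' b'' ->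
  (forall z, a z = b z -> a' z = b' z -> a'' z = b'' z -> f z = g z) -> eqT f g.
Proof.
rewrite /eqT /ae_eq => ab ab' ab'' h; apply: filterS3 ab ab' ab'' => t /= e e' e'' It.
by apply: h; [apply: e | apply: e' | apply: e''].
Qed.

Lemma intT_eq f g : measurable_circle f -> measurable_circle g -> eqT f g -> intT f = intT g.
Proof.
move=> [a b] [c d] fg; rewrite /intT /Rintegral; congr (fine _ +i* fine _);
by apply: ae_eq_integral; (try exact/measurable_EFinP) => //;
   rewrite /ae_eq; apply: filterS fg => t /= e It; rewrite e.
Qed.
Lemma integrable_ae_le (F G : R -> R) : measurable_fun I F -> mu.-integrable I (EFin \o G) ->
  (\forall t \ae mu, I t -> `|F t| <= G t) -> mu.-integrable I (EFin \o F).
Proof.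
move=> mF iG le; apply/integrableP; split; first exact/measurable_EFinP.
have /integrableP[mG] := iG; apply: le_lt_trans; apply: ae_ge0_le_integral => //.
- by apply/measurable_EFinP; exact: measurableT_comp.
- by apply: measurableT_comp.
- by apply: filterS le => t /= h It; rewrite lee_fin (le_trans (h It)) ?ler_norm.
Qed.

Lemma L2_meas f : L2 f -> measurable_circle f. Proof. by case. Qed.
Hint Resolve L2_meas : core.

Lemma measurable_sqabs f : measurable_circle f ->
  measurable_fun I (fun t => sqabs (f (expi t))).
Proof. by move=> [a b]; apply: measurable_funD; apply: measurable_funX. Qed.

Lemma L2_le f (F : R -> R) : measurable_circle f -> mu.-integrable I (EFin \o F) ->
  (forall t, sqabs (f (expi t)) <= F t) -> L2 f.
Proof.
move=> mf iF le; split=> //; apply: (le_integrable measurable_itv01 _ _ iF).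
  by apply/measurable_EFinP; apply: measurable_sqabs.
move=> t _; rewrite /= lee_fin ger0_norm ?sqabs_ge0 //.
by apply: le_trans (le _) (ler_norm _).
Qed.

Lemma L2_sq f : L2 f -> mu.-integrable I (EFin \o (fun t => sqabs (f (expi t)))).
Proof. by case. Qed.

Lemma L2_add f g : L2 f -> L2 g -> L2 (fun z => f z + g z).
Proof.
move=> lf lg.
apply: (L2_le (measurable_circleD (L2_meas lf) (L2_meas lg))
  (integrable_add (integrable_scale 2 (L2_sq lf)) (integrable_scale 2 (L2_sq lg)))).
by move=> t; apply: sqabsD_le.
Qed.
Lemma L2_scale w f : L2 f -> L2 (fun z => w * f z).
Proof.
move=> lf.
apply: (L2_le (measurable_circleM (measurable_circle_cst w) (L2_meas lf))
  (integrable_scale (sqabs w) (L2_sq lf))).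
by move=> t; rewrite sqabsM.
Qed.
Lemma L2_opp f : L2 f -> L2 (fun z => - f z).
Proof. by move=> /(L2_scale (-1)); under eq_fun do rewrite mulN1r. Qed.
Lemma L2_sub f g : L2 f -> L2 g -> L2 (fun z => f z - g z).
Proof. by move=> lf /L2_opp; apply: L2_add. Qed.
Lemma L2_conj f : L2 f -> L2 (fun z => (f z)^*).
Proof.
move=> lf; split; first exact: measurable_circle_conj (L2_meas lf).
case: lf => _; congr (mu.-integrable _ _).
by apply/funext => t; rewrite sqabs_conj.
Qed.
Lemma L2_eq f g : measurable_circle g -> eqT f g -> L2 f -> L2 g.
Proof.
move=> mg fg [mf lf]; split => //; apply: integrable_ae_le (measurable_sqabs mg) lf _.
by apply: filterS fg => t /= e It; rewrite e // ger0_norm ?sqabs_ge0.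
Qed.
Lemma L2_cst w : L2 (fun=> w).
Proof.
split; first exact: measurable_circle_cst.
apply/integrableP; split; first exact/measurable_EFinP/measurable_cst.
rewrite /= integral_cst //= lebesgue_measure_itv /= lte01 oppr0 adde0 mule1.
exact: ltry.
Qed.

Lemma L2_mul f g : L2 f -> L2 g -> L1 (fun z => f z * g z).
Proof.
move=> lf lg.
apply: (L1_le (measurable_circleM (L2_meas lf) (L2_meas lg)) (integrable_add (L2_sq lf) (L2_sq lg))) => t;
rewrite ?Re_mul ?Im_mul /sqabs; case: (f _) (g _) => a b [c d] /=;
have := (sqr_ge0 (a - c), sqr_ge0 (a + c), sqr_ge0 (b - d), sqr_ge0 (b + d)) => -[[[]]];
have := (sqr_ge0 (a - d), sqr_ge0 (a + d), sqr_ge0 (b - c), sqr_ge0 (b + c)) => -[[[]]];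
rewrite ler_norml !expr2 => *; apply/andP; split; lra.
Qed.
Lemma L2_inner f g : L2 f -> L2 g -> L1 (fun z => f z * (g z)^*).
Proof. by move=> lf /L2_conj; apply: L2_mul. Qed.
Lemma L2_L1 f : L2 f -> L1 f.
Proof.
move=> lf; have := L2_mul lf (L2_cst 1).
by under eq_fun do rewrite mulr1.
Qed.

(** The multipliers of L2 are the essentially bounded functions. In this form
    their stability under sums, products and conjugation is immediate, and no
    bound has to be carried along. *)
Definition multiplier u : Prop := forall g, L2 g -> L2 (fun z => u z * g z).

Lemma multiplier_L2 u : multiplier u -> L2 u.
Proof. by move=> /(_ _ (L2_cst 1)); under eq_fun do rewrite mulr1. Qed.
Lemma multiplier_cst w : multiplier (fun=> w).
Proof. by move=> g; apply: L2_scale. Qed.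
Lemma multiplier_add u u' : multiplier u -> multiplier u' -> multiplier (fun z => u z + u' z).
Proof.
by move=> mu_ mv g lg; under eq_fun do rewrite mulrDl; apply: L2_add; [apply: mu_|apply: mv].
Qed.
Lemma multiplier_mul u u' : multiplier u -> multiplier u' -> multiplier (fun z => u z * u' z).
Proof.
by move=> mu_ mv g lg; under eq_fun do rewrite -mulrA; apply: mu_; apply: mv.
Qed.
Lemma multiplier_opp u : multiplier u -> multiplier (fun z => - u z).
Proof. by move=> /(multiplier_mul (multiplier_cst (-1))); under eq_fun do rewrite mulN1r. Qed.
Lemma multiplier_sub u u' : multiplier u -> multiplier u' -> multiplier (fun z => u z - u' z).
Proof. by move=> mu_ /multiplier_opp; apply: multiplier_add. Qed.
Lemma multiplier_conj u : multiplier u -> multiplier (fun z => (u z)^*).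
Proof.
move=> mu_ g /L2_conj /mu_ /L2_conj.
by under eq_fun do rewrite rmorphM /= conjCK.
Qed.
Lemma multiplier_norm1 u : measurable_circle u -> eqT (fun z => `|u z|) (fun=> 1) -> multiplier u.
Proof.
move=> mu_ u1 g [mg lg]; split; first exact: measurable_circleM.
apply: integrable_ae_le lg _.
  by apply: (@measurable_sqabs (fun z => u z * g z)); apply: measurable_circleM.
apply: filterS u1 => t /= e It; rewrite sqabsM sqabs_norm1 ?mul1r; last exact: e.
by rewrite ger0_norm ?sqabs_ge0.
Qed.
Lemma multiplier_id : multiplier (fun z => z : C).
Proof.
apply: multiplier_norm1; first exact: measurable_circle_id.
by apply: eqT1 (eqT_refl (fun=> 0)) _ => z _; apply: circle_norm.
Qed.
Lemma circle_conjV (z : T) : (z : C)^* = (z : C)^-1.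
Proof.
have z1 := circle_norm z.
have z0 : (z : C) != 0 by rewrite -normr_gt0 z1 ltr01.
by apply: (mulfI z0); rewrite divff // -normCK z1 expr1n.
Qed.
Lemma circle_neq0 (z : T) : (z : C) != 0.
Proof. by rewrite -normr_gt0 circle_norm ltr01. Qed.

End Integration.
#[global] Hint Resolve measurable_itv01 L2_meas : core.

(** * Uniqueness of Fourier coefficients *)

Section FourierUniqueness.
Context {R : realType}.
Local Notation C := R[i].
Local Notation T := (circle R).
Local Notation mu := (@lebesgue_measure R).
Local Notation I := `[0 : R, 1 : R]%classic.
Local Notation Re := complex.Re.
Local Notation Im := complex.Im.
Implicit Types (f g h u : T -> C) (w : C).

Lemma one_add_mul_le_exp (y : R) n : 0 <= y -> 1 + n%:R * y <= (1 + y) ^+ n.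
Proof.
move=> y0; elim: n => [|n IH]; first by rewrite mul0r addr0 expr0.
rewrite exprS -natr1; apply: le_trans (ler_wpM2l _ IH); last lra.
have : 0 <= n%:R * y * y by rewrite !mulr_ge0.
by lra.
Qed.
Lemma one_sub_mul_le_exp (y : R) n : 0 <= y <= 1 -> 1 - n%:R * y <= (1 - y) ^+ n.
Proof.
move=> /andP[y0 y1]; elim: n => [|n IH]; first by rewrite mul0r subr0 expr0.
rewrite exprS -natr1; apply: le_trans (ler_wpM2l _ IH); last lra.
have : 0 <= n%:R * y * y by rewrite !mulr_ge0.
by lra.
Qed.

(** On [0, 1] these polynomials tend to 1 to the left of 1/2 and to 0 to the
    right of it, because the exponent 2^n compares s^n with 2^-n. They serve to
    approximate indicators of arcs by polynomials in z and conj z. *)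
Definition bump n (s : R) : R := (1 - s ^+ n) ^+ (2 ^ n).

Lemma bump_bound n s : 0 <= s <= 1 -> 0 <= bump n s <= 1.
Proof.
move=> /andP[s0 s1]; have e0 : 0 <= s ^+ n by exact: exprn_ge0.
have e1 : s ^+ n <= 1 by exact: exprn_ile1.
by rewrite exprn_ge0 ?exprn_ile1 //; lra.
Qed.

(** By Bernoulli's inequality, (1 - s^n)^(2^n) >= 1 - (2 s)^n. *)
Lemma bump_cvg1 s : 0 <= s < 2^-1 -> bump n s @[n --> \oo] --> (1 : R).
Proof.
move=> /andP[s0 s1].
have h n : 1 - (2 * s) ^+ n <= bump n s <= 1.
  have e0 : 0 <= s ^+ n by exact: exprn_ge0.
  have e1 : s ^+ n <= 1 by apply: exprn_ile1 => //; lra.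
  apply/andP; split; last by rewrite (andP (bump_bound n _)).2 //; apply/andP; split=> //; lra.
  have -> : (2 * s) ^+ n = (2 ^ n)%:R * s ^+ n by rewrite exprMn natrX.
  by apply: one_sub_mul_le_exp; rewrite e0.
apply: (@squeeze_cvgr _ _ _ _ (fun n => 1 - (2 * s) ^+ n) (fun=> 1)); first exact: nearW.
  rewrite -[X in _ --> X]subr0; apply: cvgB; first exact: cvg_cst.
  by apply: cvg_expr; rewrite ger0_norm; lra.
exact: cvg_cst.
Qed.

(** From (1 - y)^m (1 + y)^m <= 1 and (1 + y)^m >= m y, with y = s^n and
    m = 2^n, one gets (1 - s^n)^(2^n) <= (2 s)^-n. *)
Lemma bump_cvg0 s : 2^-1 < s <= 1 -> bump n s @[n --> \oo] --> (0 : R).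
Proof.
move=> /andP[s0 s1].
have h n : 0 <= bump n s <= ((2 * s)^-1) ^+ n.
  have e0 : 0 <= s ^+ n by apply: exprn_ge0; lra.
  have e1 : s ^+ n <= 1 by apply: exprn_ile1 => //; lra.
  have b0 : 0 <= bump n s by apply: exprn_ge0; lra.
  rewrite b0 /= exprVn; set b := (2 * s) ^+ n.
  have bp : 0 < b by apply: exprn_gt0; lra.
  rewrite -[leRHS]mul1r ler_pdivlMr //.
  have bE : b = (2 ^ n)%:R * s ^+ n by rewrite /b exprMn natrX.
  have le1 : b <= (1 + s ^+ n) ^+ (2 ^ n).
    by rewrite bE; apply: le_trans (one_add_mul_le_exp _ e0); lra.
  apply: (le_trans (ler_wpM2l b0 le1)); rewrite /bump -exprMn.
  by apply: exprn_ile1; nra.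
apply: (@squeeze_cvgr _ _ _ _ (fun=> 0) (fun n => (2 * s)^-1 ^+ n)); first exact: nearW.
  exact: cvg_cst.
apply: cvg_expr; rewrite ger0_norm ?invr_ge0; last lra.
by rewrite invf_lt1; lra.
Qed.

(** This function of t lies in [0, 1], is below 1/2 for 0 < t < x and above it
    for x < t < 1. By the product formula for sines it is a trigonometric
    polynomial of degree one; see [arc_sep_val]. *)
Definition sep_val (x t : R) : R := 2^-1 - sin (pi * t) * sin (pi * (x - t)) / 2.

Lemma sep_val_bound x t : 0 <= sep_val x t <= 1.
Proof.
have : `|sin (pi * t) * sin (pi * (x - t))| <= 1.
  by rewrite normrM -[leRHS]mul1r ler_pM // ler_norml sin_geN1 sin_le1.
by rewrite /sep_val ler_norml => /andP[a b]; apply/andP; split; lra.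
Qed.

Lemma sin_pi_gt0 (t : R) : 0 < t < 1 -> 0 < sin (pi * t).
Proof.
move=> /andP[t0 t1]; apply: sin_gt0_pi.
by rewrite mulr_gt0 ?pi_gt0 // -[ltRHS]mulr1 ltr_pM2l ?pi_gt0.
Qed.
Lemma sep_val_lt x t : 0 < x < 1 -> 0 < t -> t < x -> sep_val x t < 2^-1.
Proof.
move=> /andP[x0 x1] t0 tx; have a : 0 < sin (pi * t) by apply: sin_pi_gt0; lra.
have b : 0 < sin (pi * (x - t)) by apply: sin_pi_gt0; lra.
have := mulr_gt0 a b; rewrite /sep_val; lra.
Qed.
Lemma sep_val_gt x t : 0 < x < 1 -> t < 1 -> x < t -> 2^-1 < sep_val x t.
Proof.
move=> /andP[x0 x1] t0 tx; have a : 0 < sin (pi * t) by apply: sin_pi_gt0; lra.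
have b : 0 < sin (pi * (t - x)) by apply: sin_pi_gt0; lra.
have := mulr_gt0 a b; rewrite /sep_val -(opprB t x) mulrN sinN; lra.
Qed.

(** The class of these functions is stable under multiplication by z and
    conj z, hence by every trigonometric polynomial; applied to the
    polynomials above, this is how the vanishing of the coefficients is used. *)
Definition fourier_null f : Prop := L2 f /\ forall n, fourier f n = 0.
Definition preserves_null u : Prop := forall f, fourier_null f -> fourier_null (fun z => u z * f z).

Lemma preserves_null_ext u u' : u =1 u' -> preserves_null u -> preserves_null u'.
Proof. by move=> /funext ->. Qed.

Lemma multiplier_exp u n : multiplier u -> multiplier (fun z => u z ^+ n).
Proof.
move=> mu_; elim: n => [|n IH]; first exact: (multiplier_cst 1).
have -> : (fun z => u z ^+ n.+1) = (fun z => u z * u z ^+ n).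
  by apply/funext => z; rewrite exprS.
exact: multiplier_mul.
Qed.
Lemma multiplier_zpow (n : int) : multiplier (fun z : T => (z : C) ^ n).
Proof.
case: n => n; first exact: (multiplier_exp n multiplier_id).
have -> : (fun z : T => (z : C) ^ Negz n) = (fun z => ((z : C) ^+ n.+1)^*).
  by apply/funext => z; rewrite NegzE -exprnN rmorphXn /= circle_conjV exprVn.
exact/multiplier_conj/multiplier_exp/multiplier_id.
Qed.
Lemma fourier_L2 f (n : int) : L2 f -> L1 (fun z => f z * (z : C) ^ (- n)).
Proof. by move=> lf; apply: L2_mul => //; exact/multiplier_L2/multiplier_zpow. Qed.

Lemma preserves_null_cst w : preserves_null (fun=> w).
Proof.
move=> f [lf f0]; split; first exact: L2_scale.
move=> n; rewrite /fourier.
have -> : (fun z : T => w * f z * (z : C) ^ (- n)) = (fun z => w * (f z * (z : C) ^ (- n))).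
  by apply/funext => z; rewrite mulrA.
by rewrite intT_scale; [rewrite [intT _](f0 n) mulr0 | exact: fourier_L2].
Qed.
Lemma preserves_null_add u u' : preserves_null u -> preserves_null u' -> preserves_null (fun z => u z + u' z).
Proof.
move=> pu pu' f nf; have [lu u0] := pu f nf; have [lu' u0'] := pu' f nf.
have -> : (fun z => (u z + u' z) * f z) = (fun z => u z * f z + u' z * f z).
  by apply/funext => z; rewrite mulrDl.
split; first exact: L2_add.
move=> n; rewrite /fourier.
have -> : (fun z : T => (u z * f z + u' z * f z) * (z : C) ^ (- n)) =
  (fun z => u z * f z * (z : C) ^ (- n) + u' z * f z * (z : C) ^ (- n)).
  by apply/funext => z; rewrite mulrDl.
rewrite intT_add; [|exact: (@fourier_L2 (fun z => u z * f z))|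
  exact: (@fourier_L2 (fun z => u' z * f z))].
by rewrite [intT _](u0 n) [intT _](u0' n) addr0.
Qed.
Lemma preserves_null_mul u u' : preserves_null u -> preserves_null u' -> preserves_null (fun z => u z * u' z).
Proof.
move=> pu pu' f nf; have := pu _ (pu' f nf); congr fourier_null.
by apply/funext => z; rewrite mulrA.
Qed.
Lemma preserves_null_exp u n : preserves_null u -> preserves_null (fun z => u z ^+ n).
Proof.
move=> pu; elim: n => [|n IH]; first exact: (preserves_null_cst 1).
apply: (@preserves_null_ext (fun z => u z * u z ^+ n)); last exact: preserves_null_mul.
by move=> z; rewrite exprS.
Qed.
Lemma preserves_null_zpow (k : int) : preserves_null (fun z : T => (z : C) ^ k).
Proof.
move=> f [lf f0]; split; first exact: multiplier_zpow.
move=> n; rewrite -(f0 (n - k)) /fourier; congr intT; apply/funext => z.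
by rewrite mulrAC -expfzDr ?circle_neq0 // mulrC opprB.
Qed.

Lemma arc_sep_val (x t : R) : (sep_val x t)%:C =
  (2^-1 + cos (pi * x) / 4)%:C
  + ((- cos (pi * x) / 8) +i* (sin (pi * x) / 8)) * (expi t : C) ^ (1 : int)
  + ((- cos (pi * x) / 8) +i* (- sin (pi * x) / 8)) * (expi t : C) ^ (- 1 : int).
Proof.
have e2 : 2 * pi * t = (pi * t) *+ 2 by rewrite -[RHS]mulr_natl mulrA.
rewrite expr1z exprN1 -circle_conjV /= /sep_val mulrBr sinB e2 sin_mulr2n cos_mulr2n.
have := cos2Dsin2 (pi * t).
move: (sin (pi * t)) (cos (pi * t)) (sin (pi * x)) (cos (pi * x)) => s c s' c' h.
apply/eqP; rewrite eq_complex !(Re_add, Im_add, Re_mul, Im_mul) /=.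
have h' : c ^+ 2 * c' = c' - s ^+ 2 * c' by (have -> : c ^+ 2 = 1 - s ^+ 2 by lra); rewrite mulrBl mul1r.
apply/andP; split; apply/eqP; last by lra.
by lra.
Qed.

Lemma ae_neq (y : R) : \forall t \ae mu, t != y.
Proof.
exists [set y]; split => //; first exact: lebesgue_measure_set1.
by move=> t /= /negP; rewrite negbK => /eqP.
Qed.

(** The functions bump n (sep_val x t) tend to the indicator of [0, x] except
    at 0, x and 1, so dominated convergence applies. *)
Lemma bump_int_eq0 (F : R -> R) (x : R) : mu.-integrable I (EFin \o F) -> 0 < x < 1 ->
  (forall n, \int[mu]_(t in I) (bump n (sep_val x t) * F t) = 0) ->
  \int[mu]_(t in `[0, x]) F t = 0.
Proof.
move=> iF x01 h; have [x0 x1] := andP x01.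
have mF : measurable_fun I F by apply/measurable_EFinP; exact: measurable_int iF.
have mb n : measurable_fun I (fun t => bump n (sep_val x t)).
  apply: measurable_funTS; apply: measurable_funX; apply: measurable_funB => //.
  apply: measurable_funX; apply: measurable_funB => //; apply: measurable_funM => //.
  have ms (G : R -> R) : measurable_fun setT G -> measurable_fun setT (fun t => sin (pi * G t)).
    move=> mG; apply: measurableT_comp; last exact: measurable_funM.
    by apply: continuous_measurable_fun => y; exact: continuous_sin.
  by apply: measurable_funM; apply: ms => //; apply: measurable_funB.
have mbF n : measurable_fun I (fun t => bump n (sep_val x t) * F t) by exact: measurable_funM.
have sub : `[0, x]%classic `<=` I.
  by move=> t /=; rewrite !in_itv /= => /andP[-> /le_trans]; apply; exact: ltW.
have -> : `[0, x]%classic = I `&` `[0, x]%classic by apply/esym/setIidPr.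
rewrite Rintegral_mkcondr.
pose f_ n t := ((bump n (sep_val x t) * F t)%:E : \bar R).
have [|||||_ _] := @dominated_convergence _ _ _ mu _ measurable_itv01 f_
  (EFin \o (F \_ `[0, x])) (fun t => `|F t|%:E).
- by move=> n; apply/measurable_EFinP; exact: mbF.
- apply/measurable_EFinP; apply/(measurable_restrict _ _ _).1 => //.
  by apply: measurable_funS mF => // t [].
- apply: filterS3 (ae_neq 0) (ae_neq 1) (ae_neq x) => t t0 t1 tx It.
  move: It; rewrite /= in_itv /= => /andP[]; rewrite le_eqVlt eq_sym (negbTE t0) /= => t0'.
  rewrite le_eqVlt (negbTE t1) /= => t1'.
  apply/cvg_EFin; first by near=> n.
  have [b0 b1] := andP (sep_val_bound x t).
  have -> : (F \_ `[0, x]) t = (if t < x then 1 else 0) * F t.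
    rewrite patchE; case: ifPn; rewrite ?in_setE ?notin_setE /= in_itv /= (ltW t0') /=.
      by rewrite le_eqVlt (negbTE tx) /= => ->; rewrite mul1r.
    by move/negP; rewrite -ltNge => /ltW; rewrite leNgt => /negbTE ->; rewrite mul0r.
  apply: cvgM; last exact: cvg_cst.
  case: ifPn => [tx'|]; first by apply: bump_cvg1; rewrite b0 sep_val_lt.
  rewrite -leNgt le_eqVlt eq_sym (negbTE tx) /= => tx'.
  by apply: bump_cvg0; rewrite b1 sep_val_gt.
- exact: integrable_norm.
- apply: filterE => t n _ /=; rewrite lee_fin normrM -[leRHS]mul1r ler_wpM2r //.
  by have /andP[a b] := bump_bound n (sep_val_bound x t); rewrite ger0_norm.
have -> : (fun n => \int[mu]_(t in I) f_ n t)%E = fun=> 0%E.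
  apply/funext => n.
  have fin : (\int[mu]_(t in I) f_ n t)%E \is a fin_num.
    apply: integrable_fin_num => //; apply: (le_integrable measurable_itv01 _ _ iF).
      by apply/measurable_EFinP; exact: mbF.
    move=> t _; rewrite /= lee_fin normrM -[leRHS]mul1r ler_wpM2r //.
    by have /andP[a b] := bump_bound n (sep_val_bound x t); rewrite ger0_norm.
  by rewrite -(fineK fin); congr EFin; exact: h.
by move=> c0; rewrite /Rintegral -(cvg_unique _ (cvg_cst 0%E) c0).
Unshelve. all: by end_near.
Qed.

(** By Lebesgue's differentiation theorem F is almost everywhere the derivative
    of its primitive. *)
Lemma ae_eq0_of_primitive (F : R -> R) : mu.-integrable I (EFin \o F) ->
  (forall x, 0 < x < 1 -> \int[mu]_(t in `[0, x]) F t = 0) ->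
  \forall t \ae mu, I t -> F t = 0.
Proof.
move=> iF F0; pose G := F \_ I.
have lG : locally_integrable setT G by exact: integrable_locally.
apply: filterS3 (ae_neq 0) (ae_neq 1) (lebesgue_differentiation lG) => t t0 t1 lt It.
move: (It); rewrite /= in_itv /= => /andP[]; rewrite le_eqVlt eq_sym (negbTE t0) /= => t0'.
rewrite le_eqVlt (negbTE t1) /= => t1'.
have iG : mu.-integrable `[0, 1] (EFin \o G).
  by apply: eq_integrable iF => // s sI; rewrite /= /G patchE sI.
have [dG] := FTC1_lebesgue_pt t1' iG t0' lt.
rewrite /G patchE mem_set // => <-.
rewrite derive1E (@near_eq_derive _ _ _ _ (cst 0)) ?derive_cst //.
near=> y.
have y01 : 0 < y < 1 by apply/andP; split; near: y; [exact: lt_nbhsr|exact: lt_nbhsl].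
rewrite -[RHS](F0 y y01); apply: eq_Rintegral => s; rewrite in_setE /= in_itv /= => /andP[s0 sy].
rewrite /G patchE mem_set //= in_itv /= s0 (le_trans sy) //.
by case/andP: y01 => _ /ltW.
Unshelve. all: by end_near.
Qed.

Definition arc_sep (x : R) : T -> C := fun z => 
  ((2^-1 + cos (pi * x) / 4)%:C
  + ((- cos (pi * x) / 8) +i* (sin (pi * x) / 8)) * (z : C) ^ (1 : int))
  + ((- cos (pi * x) / 8) +i* (- sin (pi * x) / 8)) * (z : C) ^ (- 1 : int).

Lemma preserves_null_arc_sep x : preserves_null (arc_sep x).
Proof.
apply: preserves_null_add; last first.
  by apply: preserves_null_mul; [exact: preserves_null_cst|exact: preserves_null_zpow].
apply: preserves_null_add; first exact: preserves_null_cst.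
by apply: preserves_null_mul; [exact: preserves_null_cst|exact: preserves_null_zpow].
Qed.

(** The primitives of the real and imaginary parts vanish, being limits of
    integrals of f against trigonometric polynomials. *)
Lemma fourier_null_eq0 f : fourier_null f -> eqT f (fun=> 0).
Proof.
move=> [lf f0].
have hb x n : intT (fun z => (1 - arc_sep x z ^+ n) ^+ (2 ^ n) * f z) = 0.
  have pb : preserves_null (fun z => (1 + (-1) * arc_sep x z ^+ n) ^+ (2 ^ n)).
    apply: preserves_null_exp; apply: preserves_null_add; first exact: preserves_null_cst.
    apply: preserves_null_mul; first exact: preserves_null_cst.
    by apply: preserves_null_exp; exact: preserves_null_arc_sep.
  have [_ /(_ 0)] := pb f (conj lf f0); rewrite /fourier oppr0 => <-.
  by congr intT; apply/funext => z; rewrite expr0z mulr1 mulN1r.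
have hv x n t : (1 - arc_sep x (expi t) ^+ n) ^+ (2 ^ n) = (bump n (sep_val x t))%:C.
  have gen (s : R) : (1 - s%:C ^+ n) ^+ (2 ^ n) = (bump n s)%:C.
    by rewrite /bump rmorphXn rmorphB rmorphXn.
  by rewrite -gen arc_sep_val.
have [iRe iIm] := L2_L1 lf.
have aRe : \forall t \ae mu, I t -> Re (f (expi t)) = 0.
  apply: (ae_eq0_of_primitive iRe) => x x01; apply: (bump_int_eq0 iRe x01) => n.
  have /(congr1 (@complex.Re R)) := hb x n; rewrite /intT /= => e; rewrite -[RHS]e.
  by apply: eq_Rintegral => t _; rewrite hv Re_mul /= mul0r subr0.
have aIm : \forall t \ae mu, I t -> Im (f (expi t)) = 0.
  apply: (ae_eq0_of_primitive iIm) => x x01; apply: (bump_int_eq0 iIm x01) => n.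
  have /(congr1 (@complex.Im R)) := hb x n; rewrite /intT /= => e; rewrite -[RHS]e.
  by apply: eq_Rintegral => t _; rewrite hv Im_mul /= mul0r addr0.
apply: filterS2 aRe aIm => t /= a b It; apply/eqP.
by rewrite eq_complex a // b //= eqxx.
Qed.

End FourierUniqueness.

(** * Completeness of L2 and orthogonal projections *)

Section Hilbert.
Context {R : realType}.
Local Notation C := R[i].
Local Notation T := (circle R).
Local Notation mu := (@lebesgue_measure R).
Local Notation I := `[0 : R, 1 : R]%classic.
Local Notation Re := complex.Re.
Local Notation Im := complex.Im.
Implicit Types (f g h u : T -> C) (w : C).

Definition sqnorm f : R := \int[mu]_(t in I) sqabs (f (expi t)).

Lemma sqnorm_ge0 f : 0 <= sqnorm f.
Proof. by apply: Rintegral_ge0 => t _; apply: sqabs_ge0. Qed.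

Lemma inner_self f : inner f f = (sqnorm f)%:C.
Proof.
apply/eqP; rewrite eq_complex /=; apply/andP; split; apply/eqP.
  by apply: eq_Rintegral => t _; rewrite mul_conj_sqabs.
transitivity (\int[mu]_(t in I) (0 : R)); last by rewrite Rintegral_cst ?mul0r.
by apply: eq_Rintegral => t _; rewrite mul_conj_sqabs.
Qed.
Lemma inner_conj f g : L2 f -> L2 g -> inner g f = (inner f g)^*.
Proof.
move=> lf lg; rewrite /inner -intT_conj; last exact: L2_inner.
by congr intT; apply/funext => z; rewrite rmorphM /= conjCK mulrC.
Qed.
Lemma inner_addl f g h : L2 f -> L2 g -> L2 h ->
  inner (fun z => f z + g z) h = inner f h + inner g h.
Proof.
move=> lf lg lh; rewrite /inner -intT_add; try exact: L2_inner.
by congr intT; apply/funext => z; rewrite mulrDl.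
Qed.
Lemma inner_scalel w f h : L2 f -> L2 h -> inner (fun z => w * f z) h = w * inner f h.
Proof.
move=> lf lh; rewrite /inner -intT_scale; last exact: L2_inner.
by congr intT; apply/funext => z; rewrite mulrA.
Qed.
Lemma inner_subl f g h : L2 f -> L2 g -> L2 h ->
  inner (fun z => f z - g z) h = inner f h - inner g h.
Proof.
move=> lf lg lh; rewrite -[- inner g h]mulN1r -inner_scalel // -inner_addl //.
  by congr inner; apply/funext => z; rewrite mulN1r.
exact: L2_scale.
Qed.
Lemma inner_addr f g h : L2 f -> L2 g -> L2 h ->
  inner h (fun z => f z + g z) = inner h f + inner h g.
Proof.
move=> lf lg lh; by rewrite (inner_conj (L2_add lf lg) lh) inner_addl // rmorphD /= -!inner_conj.
Qed.
Lemma inner_scaler w f h : L2 f -> L2 h -> inner h (fun z => w * f z) = w^* * inner h f.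
Proof.
move=> lf lh; by rewrite (inner_conj (L2_scale w lf) lh) inner_scalel // rmorphM /= -inner_conj.
Qed.
Lemma inner_subr f g h : L2 f -> L2 g -> L2 h ->
  inner h (fun z => f z - g z) = inner h f - inner h g.
Proof.
move=> lf lg lh; by rewrite (inner_conj (L2_sub lf lg) lh) inner_subl // rmorphB /= -!inner_conj.
Qed.
Lemma inner_eq f g f' g' : measurable_circle f -> measurable_circle g ->
  measurable_circle f' -> measurable_circle g' ->
  eqT f f' -> eqT g g' -> inner f g = inner f' g'.
Proof.
move=> mf mg mf' mg' ff' gg'; apply: intT_eq;
  try by apply: measurable_circleM => //; apply: measurable_circle_conj.
by apply: (eqT2 ff' gg') => z -> ->.
Qed.

Lemma sqnorm_Re f : sqnorm f = Re (inner f f). Proof. by rewrite inner_self. Qed.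

Lemma sqnorm_add w f g : L2 f -> L2 g ->
  sqnorm (fun z => f z + w * g z) = sqnorm f + 2 * Re (w^* * inner f g) + sqabs w * sqnorm g.
Proof.
move=> lf lg; have lwg := L2_scale w lg.
rewrite !sqnorm_Re inner_addl ?inner_addr ?inner_scalel ?inner_scaler //; last exact: L2_add.
rewrite (inner_conj lf lg) mulrA mul_conj_sqabs !Re_add.
have -> : w * (inner f g)^* = (w^* * inner f g)^* by rewrite rmorphM /= conjCK.
rewrite creal_conj Re_mul /= mul0r subr0; ring.
Qed.

(** This form of the Cauchy-Schwarz inequality, with a parameter s to be chosen,
    avoids square roots. *)
Lemma Re_inner_le (s : R) f g : 0 < s -> L2 f -> L2 g ->
  2 * Re (inner f g) <= s * sqnorm f + s^-1 * sqnorm g.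
Proof.
move=> s0 lf lg; have := sqnorm_ge0 (fun z => g z + (- s)%:C * f z).
have lsf := L2_scale (- s)%:C lf.
rewrite sqnorm_add // [inner g f]inner_conj // Re_mul.
have -> : Re ((- s)%:C : C)^* = - s by rewrite creal_conj.
have -> : Im ((- s)%:C : C)^* = 0 by rewrite cimag_conj /= oppr0.
have -> : sqabs ((- s)%:C : C) = s * s by rewrite /sqabs /=; ring.
rewrite creal_conj mul0r subr0 => h.
have si : 0 < s^-1 by rewrite invr_gt0.
have := mulr_ge0 (ltW si) h.
rewrite !mulrDr !mulrA mulVf ?gt_eqF // mul1r mulrN => h'.
have e : s^-1 * 2 * - s = -2 by field; rewrite gt_eqF.
have : s^-1 * 2 * - s * Re (inner f g) = -2 * Re (inner f g) by rewrite e.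
lra.
Qed.

(** The sequences x n - 2 r 2^-n and x n + 2 r 2^-n are monotone and enclose
    the limit, which gives both its existence and the rate. *)
Lemma geometric_cauchy (x : nat -> R) r : (forall n, `|x n.+1 - x n| <= r * 2^-1 ^+ n) ->
  exists2 l, x n @[n --> \oo] --> l & forall n, `|l - x n| <= 2 * r * 2^-1 ^+ n.
Proof.
move=> h; pose y n := x n - 2 * r * 2^-1 ^+ n; pose z n := x n + 2 * r * 2^-1 ^+ n.
have r0 : 0 <= r by have := le_trans (normr_ge0 _) (h 0%N); rewrite expr0 mulr1.
have p0 n : 0 <= r * 2^-1 ^+ n by rewrite mulr_ge0 ?exprn_ge0.
have hp n : 2^-1 ^+ n.+1 = 2^-1 * 2^-1 ^+ n :> R by rewrite exprS.
have yS n : y n <= y n.+1.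
  by have := h n; rewrite ler_norml /y hp => /andP[a b]; have := p0 n; lra.
have zS n : z n.+1 <= z n.
  by have := h n; rewrite ler_norml /z hp => /andP[a b]; have := p0 n; lra.
have yh : {homo y : n m / (n <= m)%N >-> n <= m} by exact/nondecreasing_seqP.
have zh : {homo z : n m / (n <= m)%N >-> m <= n} by exact/nonincreasing_seqP.
have yc : cvgn y.
  apply: nondecreasing_is_cvgn => //; exists (z 0%N) => _ [n _ <-].
  by apply: le_trans (zh _ _ (leq0n n)); rewrite /y /z; have := p0 n; lra.
have e0 : (2 * r * 2^-1 ^+ n) @[n --> \oo] --> (0 : R).
  rewrite -[X in _ --> X](mulr0 (2 * r)); apply: cvgM; first exact: cvg_cst.
  by apply: cvg_expr; rewrite ger0_norm; lra.
have xl : x n @[n --> \oo] --> limn y.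
  rewrite -[X in _ --> X]addr0; have -> : x = (fun n => y n + 2 * r * 2^-1 ^+ n).
    by apply/funext => n; rewrite /y subrK.
  exact: cvgD.
have zl : z n @[n --> \oo] --> limn y.
  by rewrite -[X in _ --> X]addr0; apply: cvgD.
exists (limn y) => // n; rewrite ler_norml; apply/andP; split.
  have := nondecreasing_cvgn_le yh yc n; rewrite /y; lra.
have := nonincreasing_cvgn_ge zh (cvgP _ zl) n; rewrite (cvg_lim _ zl) // /z; lra.
Qed.

Lemma Rintegral_ae_le (F G : R -> R) : (forall t, 0 <= F t) -> (forall t, 0 <= G t) ->
  mu.-integrable I (EFin \o F) -> mu.-integrable I (EFin \o G) ->
  (\forall t \ae mu, I t -> F t <= G t) ->
  \int[mu]_(t in I) F t <= \int[mu]_(t in I) G t.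
Proof.
move=> F0 G0 iF iG le; apply: fine_le; try exact: integrable_fin_num.
apply: ae_ge0_le_integral => //.
- by move=> t _; rewrite lee_fin.
- by have /integrableP[] := iF.
- by move=> t _; rewrite lee_fin.
- by have /integrableP[] := iG.
Qed.

(** It is enough to treat sequences that converge fast, as every Cauchy sequence
    has such a subsequence. The limit is first taken pointwise, almost
    everywhere; the limit superior gives a measurable version of it. *)
Lemma L2_complete (k : nat -> T -> C) : (forall n, L2 (k n)) ->
  (forall n, sqnorm (fun z => k n.+1 z - k n z) <= 8^-1 ^+ n) ->
  exists2 g, L2 g & exists M, forall n, sqnorm (fun z => g z - k n z) <= M * 4^-1 ^+ n.
Proof.
move=> lk hk; pose d n t := sqabs (k n.+1 (expi t) - k n (expi t)).
have ld n : L2 (fun z => k n.+1 z - k n z) by exact: L2_sub.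
have md n : measurable_fun I (d n) by apply: (@measurable_sqabs _ (fun z => k n.+1 z - k n z)); case: (ld n).
have idn n : mu.-integrable I (EFin \o d n) by case: (ld n).
(* The weights 4^n are light enough for S to be integrable, since 4^n 8^-n is
   summable, and heavy enough for d n t <= 4^-n S t to make the values at t
   converge geometrically. *)
pose S t := (\sum_(0 <= n <oo) (4 ^+ n * d n t)%:E)%E.
have d0 n t : 0 <= d n t by exact: sqabs_ge0.
have md4 n : measurable_fun I (fun t => (4 ^+ n * d n t)%:E).
  by apply/measurable_EFinP; apply: measurable_funM.
have S0 t : (0 <= S t)%E by apply: nneseries_ge0 => n _ _; rewrite lee_fin mulr_ge0 ?exprn_ge0.
have iS : mu.-integrable I S.
  apply/integrableP; split.
    have := @ge0_emeasurable_sum _ _ _ I (fun n t => (4 ^+ n * d n t)%:E) xpredT _ (fun n _ => md4 n).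
    by apply=> n t _ _; rewrite lee_fin mulr_ge0 ?exprn_ge0.
  under eq_integral do rewrite gee0_abs //.
  rewrite /S integral_nneseries //; last by move=> n t _; rewrite lee_fin mulr_ge0 ?exprn_ge0.
  apply: (@le_lt_trans _ _ (2%:E)); last exact: ltry.
  have e2 := cvg_lim (@ereal_hausdorff R) (@cvg_geometric_eseries_half R 2 0%N).
  rewrite expr0 divr1 in e2; rewrite -e2; apply: lee_nneseries.
    by move=> n _ _; apply: integral_ge0 => t _; rewrite lee_fin mulr_ge0 ?exprn_ge0.
  move=> n _; under eq_integral do rewrite EFinM.
  rewrite ge0_integralZl_EFin ?exprn_ge0 //; last 2 first.
    by move=> t _; rewrite lee_fin; exact: d0.
    by apply/measurable_EFinP; exact: md.
  have -> : (\int[mu]_(t in I) (d n t)%:E)%E = (sqnorm (fun z => k n.+1 z - k n z))%:E.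
    by rewrite /sqnorm /Rintegral fineK //; exact: (integrable_fin_num measurable_itv01 (idn n)).
  rewrite -EFinM lee_fin.
  apply: le_trans (ler_wpM2l _ (hk n)) _; first exact: exprn_ge0.
  rewrite natrX addn1 exprS -exprMn invfM mulrA divff // mul1r -exprVn.
  by have -> : 4 * 8^-1 = 2^-1 :> R by field.
have [mS _] := integrableP _ _ _ iS.
have fS := integrable_ae measurable_itv01 iS.
pose s t := fine (S t).
have ds : \forall t \ae mu, I t -> forall n, 4 ^+ n * d n t <= s t.
  apply: filterS fS => t /= fin It n; rewrite -lee_fin /s fineK; last exact: fin.
  have h0 i : (0 <= i)%N -> true -> (0 <= (4 ^+ i * d i t)%:E)%E.
    by move=> _ _; rewrite lee_fin mulr_ge0 ?exprn_ge0.
  apply: le_trans (nneseries_lim_ge n.+1 h0).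
  rewrite big_nat_recr //=; apply: leeDr; apply: sume_ge0 => i _.
  by rewrite lee_fin mulr_ge0 ?exprn_ge0.
have is_ : mu.-integrable I (EFin \o s).
  apply: (le_integrable measurable_itv01 _ _ iS).
    by apply/measurable_EFinP; exact: (measurableT_comp (fine_measurable measurableT) mS).
  move=> t _; have e (x : \bar R) : (`|(fine x)%:E| <= `|x|)%E.
    by case: x => [r||] //=; rewrite normr0 leey.
  exact: e.
pose lims (p : C -> R) z := fine (limn_esup (fun n => (p (k n z))%:E)).
pose g z : C := lims (@complex.Re R) z +i* lims (@complex.Im R) z.
have mlims p : (forall n, measurable_fun I (fun t => p (k n (expi t)))) ->
    measurable_fun I (fun t => lims p (expi t)).
  move=> mp.
  have me : measurable_fun I (fun t => limn_esup (fun n => (p (k n (expi t)))%:E)).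
    by apply: (@measurable_fun_limn_esup _ _ _ _ (fun n t => (p (k n (expi t)))%:E)) => n;
       apply/measurable_EFinP.
  exact: (measurableT_comp (fine_measurable measurableT) me).
have mg : measurable_circle g.
  by split; apply: mlims => n; case: (L2_meas (lk n)).
have lims_le p t n : (forall w, p w ^+ 2 <= sqabs w) -> (forall w w', p (w - w') = p w - p w') ->
   (forall n, 4 ^+ n * d n t <= s t) ->
   (lims p (expi t) - p (k n (expi t))) ^+ 2 <= 4 * s t * 4^-1 ^+ n.
  move=> psq pB dst.
  have s0 : 0 <= s t by apply: le_trans (dst 0%N); rewrite expr0 mul1r.
  have hx m : `|p (k m.+1 (expi t)) - p (k m (expi t))| <= Num.sqrt (s t) * 2^-1 ^+ m.
    rewrite -ler_sqr ?nnegrE ?mulr_ge0 ?sqrtr_ge0 ?exprn_ge0 //.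
    rewrite real_normK ?num_real // -pB exprMn sqr_sqrtr // -exprM mulnC exprM.
    have -> : 2^-1 ^+ 2 = 4^-1 :> R by field.
    apply: le_trans (psq _) _.
    rewrite exprVn ler_pdivlMr ?exprn_gt0 // mulrC; exact: dst.
  have [l xl hl] := geometric_cauchy hx.
  have -> : lims p (expi t) = l.
    have cE : (p (k m (expi t)))%:E @[m --> \oo] --> l%:E by apply: cvg_EFin => //; near=> m.
    rewrite /lims is_cvg_limn_esupE; last by apply/cvg_ex; exists l%:E.
    by rewrite (cvg_lim _ cE).
  have : `|l - p (k n (expi t))| ^+ 2 <= (2 * Num.sqrt (s t) * 2^-1 ^+ n) ^+ 2.
    by rewrite ler_sqr ?nnegrE ?mulr_ge0 ?sqrtr_ge0 ?exprn_ge0.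
  rewrite real_normK ?num_real // !exprMn sqr_sqrtr // -exprM mulnC exprM.
  have -> : 2^-1 ^+ 2 = 4^-1 :> R by field.
  by have -> : 2 ^+ 2 = 4 :> R by ring.
have gk : \forall t \ae mu, I t -> forall n, sqabs (g (expi t) - k n (expi t)) <= 8 * s t * 4^-1 ^+ n.
  apply: filterS ds => t /= h It n; have h' := h It.
  have re : (lims (@complex.Re R) (expi t) - Re (k n (expi t))) ^+ 2 <= 4 * s t * 4^-1 ^+ n.
    by apply: lims_le => // [w|[? ?] [? ?]] //; rewrite lerDl sqr_ge0.
  have im : (lims (@complex.Im R) (expi t) - Im (k n (expi t))) ^+ 2 <= 4 * s t * 4^-1 ^+ n.
    by apply: lims_le => // [w|[? ?] [? ?]] //; rewrite lerDr sqr_ge0.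
  rewrite /sqabs.
  have -> : Re (g (expi t) - k n (expi t)) = lims (@complex.Re R) (expi t) - Re (k n (expi t)).
    by case: (k n (expi t)).
  have -> : Im (g (expi t) - k n (expi t)) = lims (@complex.Im R) (expi t) - Im (k n (expi t)).
    by case: (k n (expi t)).
  lra.
have mgk n : measurable_circle (fun z => g z - k n z).
  by apply: measurable_circleD => //; apply: L2_meas; exact: L2_opp.
have lgk n : L2 (fun z => g z - k n z).
  split=> //; apply: (@integrable_ae_le _ _ (fun t => (8 * 4^-1 ^+ n) * s t)).
  + exact: (@measurable_sqabs _ (fun z => g z - k n z)).
  + exact: integrable_scale.
  apply: filterS gk => t /= h It; rewrite ger0_norm ?sqabs_ge0 // mulrAC; exact: h.
exists g.
  have := L2_add (lgk 0%N) (lk 0%N); congr L2.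
  by apply/funext => z; rewrite subrK.
exists (8 * \int[mu]_(t in I) s t) => n.
rewrite mulrAC -RintegralZl //; apply: Rintegral_ae_le.
- by move=> t; exact: sqabs_ge0.
- by move=> t; rewrite !mulr_ge0 ?exprn_ge0 // fine_ge0.
- by case: (lgk n).
- exact: integrable_scale.
- by apply: filterS gk => t /= h It; rewrite mulrAC; exact: h.
Unshelve. all: by end_near.
Qed.

Lemma le_of_geometric (x y c : R) : (forall n, x <= y + c * 2^-1 ^+ n) -> x <= y.
Proof.
move=> h; have c1 : (fun n => y + c * 2^-1 ^+ n) @ \oo --> y.
  rewrite -[X in _ --> X]addr0; apply: cvgD; first exact: cvg_cst.
  rewrite -[X in _ --> X](mulr0 c); apply: cvgM; first exact: cvg_cst.
  by apply: cvg_expr; rewrite ger0_norm; lra.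
by apply: (ler_cvg_to (cvg_cst x) c1); apply: nearW.
Qed.

Lemma Re_inner_geometric (x : nat -> T -> C) h M n : (forall n, L2 (x n)) -> L2 h ->
  (forall n, sqnorm (x n) <= M * 4^-1 ^+ n) ->
  2 * Re (inner (x n) h) <= (M + sqnorm h) * 2^-1 ^+ n.
Proof.
move=> lx lh hM; have p2 : 0 < 2 ^+ n :> R by exact: exprn_gt0.
apply: le_trans (Re_inner_le p2 (lx n) lh) _.
rewrite mulrDl -exprVn [sqnorm h * _]mulrC lerD2r.
apply: le_trans (ler_wpM2l (ltW p2) (hM n)) _.
rewrite mulrCA -exprMn; have -> : 2 * 4^-1 = 2^-1 :> R by field.
by [].
Qed.

(** Closedness is required for sequences that converge at the rate 2^-n; every
    convergent sequence has a subsequence of this kind. *)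
Definition closed_subspace (K : set (T -> C)) : Prop :=
  [/\ K `<=` L2, K (fun=> 0),
      forall w f g, K f -> K g -> K (fun z => f z + w * g z) &
      forall (k : nat -> T -> C) g M, (forall n, K (k n)) -> L2 g ->
        (forall n, sqnorm (fun z => g z - k n z) <= M * 4^-1 ^+ n) -> K g].

Lemma sqnorm_scale w f : L2 f -> sqnorm (fun z => w * f z) = sqabs w * sqnorm f.
Proof.
move=> lf; rewrite /sqnorm -RintegralZl //; last by case: lf.
by apply: eq_Rintegral => t _; rewrite sqabsM.
Qed.

Lemma parallelogram f g : L2 f -> L2 g ->
  sqnorm (fun z => f z - g z) = 2 * sqnorm f + 2 * sqnorm g - 4 * sqnorm (fun z => 2^-1 * (f z + g z)).
Proof.
move=> lf lg; rewrite sqnorm_scale; last exact: L2_add.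
have -> : (fun z => f z - g z) = (fun z => f z + (-1) * g z).
  by apply/funext => z; rewrite mulN1r.
have -> : (fun z => f z + g z) = (fun z => f z + 1 * g z).
  by apply/funext => z; rewrite mul1r.
have -> : sqabs (2^-1 : C) = 4^-1.
  have -> : (2^-1 : C) = (2^-1 : R)%:C by rewrite fmorphV rmorph_nat.
  by rewrite /sqabs /=; field.
rewrite !sqnorm_add //.
have -> : ((-1) : C)^* = -1 by rewrite rmorphN1.
have -> : (1 : C)^* = 1 by rewrite rmorph1.
rewrite mulN1r mul1r.
have -> : sqabs (-1 : C) = 1 by rewrite /sqabs /=; ring.
have -> : sqabs (1 : C) = 1 by rewrite /sqabs /=; ring.
have -> : Re (- inner f g) = - Re (inner f g) by case: (inner f g).
by field.
Qed.

(** The classical argument: a minimising sequence for the distance is Cauchy by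
    the parallelogram identity, and the variation of the minimum in the
    direction of h gives orthogonality. *)
Lemma projection_exists (K : set (T -> C)) f : closed_subspace K -> L2 f ->
  exists g, is_proj K f g.
Proof.
move=> [KL K0 Klin Kcl] lf.
pose E := [set sqnorm (fun z => f z - k z) | k in K].
have Einf : has_inf E.
  split; first by exists (sqnorm (fun z => f z - 0)); exists (fun=> 0).
  by exists 0 => _ [k _ <-]; exact: sqnorm_ge0.
have Elb k : K k -> inf E <= sqnorm (fun z => f z - k z).
  by move=> Kk; apply: ge_inf; [case: Einf|exists k].
(* The excess 8^-n / 4 over the infimum is what the parallelogram identity
   needs to bound the squared increments by 8^-n. *)
have e0 n : 0 < 4^-1 * 8^-1 ^+ n :> R by rewrite mulr_gt0 ?exprn_gt0.
have /choice[k hk] : forall n, exists k, K k /\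
    sqnorm (fun z => f z - k z) < inf E + 4^-1 * 8^-1 ^+ n.
  by move=> n; have [_ [k Kk <-] h] := inf_adherent (e0 n) Einf; exists k.
have Kk n := (hk n).1; have lk n := KL _ (Kk n).
have ld n : L2 (fun z => f z - k n z) by exact: L2_sub.
have [g lg [M hM]] : exists2 g, L2 g & exists M, forall n, sqnorm (fun z => g z - k n z) <= M * 4^-1 ^+ n.
  apply: L2_complete => // n.
  have -> : (fun z => k n.+1 z - k n z) = (fun z => (f z - k n z) - (f z - k n.+1 z)).
    by apply/funext => z; ring.
  rewrite parallelogram //.
  pose m z := (0 + 2^-1 * k n z) + 2^-1 * k n.+1 z.
  have Km : K m by apply: (Klin) => //; exact: (Klin).
  have -> : (fun z => 2^-1 * ((f z - k n z) + (f z - k n.+1 z))) = (fun z => f z - m z).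
    by apply/funext => z; rewrite /m; field.
  have [_ a] := hk n; have [_ b] := hk n.+1; have c := Elb _ Km.
  have d : 8^-1 ^+ n.+1 = 8^-1 * 8^-1 ^+ n :> R by rewrite exprS.
  have := e0 n; rewrite d in b; lra.
have Kg : K g by exact: Kcl hM.
exists g; split => // h Kh; have lh := KL _ Kh.
(* Compare the distances from f to k n + w h and to k n, then let n grow. *)
have key w : 2 * Re (w^* * inner (fun z => f z - g z) h) <= sqabs w * sqnorm h.
  apply: (@le_of_geometric _ _ (1 + (M + sqnorm (fun z => - w * h z)))) => n.
  have Kw : K (fun z => k n z + w * h z) by exact: Klin.
  have := Elb _ Kw.
  have -> : (fun z => f z - (k n z + w * h z)) = (fun z => (f z - k n z) + (- w) * h z).
    by apply/funext => z; ring.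
  rewrite sqnorm_add //.
  have -> : sqabs (- w) = sqabs w by rewrite -mulN1r sqabsM /sqabs /=; ring.
  have lgk n' : L2 (fun z => g z - k n' z) by exact: L2_sub.
  have := Re_inner_geometric n lgk (L2_scale (- w) lh) hM.
  rewrite inner_scaler //.
  have [_ a] := hk n.
  have b : 8^-1 ^+ n <= 2^-1 ^+ n :> R by apply: lerXn2r; rewrite ?nnegrE; lra.
  have c : 0 <= 2^-1 ^+ n :> R by exact: exprn_ge0.
  have -> : inner (fun z => f z - g z) h =
    inner (fun z => f z - k n z) h - inner (fun z => g z - k n z) h.
    rewrite -inner_subl //; congr inner; apply/funext => z; ring.
  rewrite rmorphN mulrBr !mulNr.
  have reN (x : C) : Re (- x) = - Re x by case: x.
  rewrite Re_add !reN.
  lra.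
(* With w = J / (N + 1), N the squared norm of h, the bound [key] reads
   2 v |J|^2 <= v |J|^2 where v = 1 / (N + 1), so that J = 0. *)
set J := inner _ _ in key *; have := key ((sqnorm h + 1)^-1%:C * J).
have n0 := sqnorm_ge0 h; have n1 : 0 < sqnorm h + 1 by lra.
set v := (sqnorm h + 1)^-1; have v0 : 0 < v by rewrite invr_gt0.
have vN : v * sqnorm h <= 1 by rewrite mulrC ler_pdivrMr //; lra.
have -> : (v%:C * J)^* * J = v%:C * (sqabs J)%:C.
  have -> : (v%:C * J)^* = v%:C * J^*.
    by apply/eqP; rewrite eq_complex; case: J {key} => x y /=; apply/andP; split; apply/eqP; ring.
  by rewrite -mulrA [J^* * J]mulrC mul_conj_sqabs.
rewrite -rmorphM /= sqabsM.
have -> : sqabs v%:C = v * v by rewrite /sqabs /=; ring.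
have J0 := sqabs_ge0 J => le.
have le' : 2 * (v * sqabs J) <= v * sqabs J.
  apply: le_trans le _; rewrite -!mulrA ler_wpM2l ?(ltW v0) //.
  rewrite mulrCA -[leRHS]mulr1 ler_wpM2l //.
by apply: sqabs_eq0; apply/eqP; rewrite -(mulrI_eq0 _ (mulfI (lt0r_neq0 v0))); apply/eqP;
  have := mulr_ge0 (ltW v0) J0; lra.
Qed.

End Hilbert.

(** * The Hardy space and the model spaces *)

Section Hardy.
Context {R : realType}.
Local Notation C := R[i].
Local Notation T := (circle R).
Local Notation mu := (@lebesgue_measure R).
Local Notation I := `[0 : R, 1 : R]%classic.
Local Notation Re := complex.Re.
Local Notation Im := complex.Im.
Implicit Types (f g h u : T -> C) (w : C).

Lemma Rintegral_derive (F f : R -> R) : (forall x : R, is_derive x 1 F (f x)) ->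
  continuous f -> \int[mu]_(t in I) f t = F 1 - F 0.
Proof.
move=> dF cf.
have cF : continuous F.
  by move=> x; apply: differentiable_continuous; apply/derivable1_diffP; case: (dF x).
rewrite /Rintegral (@continuous_FTC2 _ f F 0 1) ?ltr01 //.
- exact: continuous_subspaceT.
- split; first by move=> x _; case: (dF x).
  + by apply: cvg_at_right_filter; exact: cF.
  + by apply: cvg_at_left_filter; exact: cF.
- by move=> x _; rewrite derive1E; apply: derive_val; exact: dF.
Qed.

Lemma expi_pow (t : R) n :
  (expi t : C) ^+ n = cos (n%:R * (2 * pi * t)) +i* sin (n%:R * (2 * pi * t)).
Proof.
elim: n => [|n IH]; first by rewrite expr0 mul0r cos0 sin0.
have e : n.+1%:R * (2 * pi * t) = n%:R * (2 * pi * t) + 2 * pi * t by rewrite -natr1; ring.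
rewrite exprS IH e cosD sinD /=.
by apply/eqP; rewrite eq_complex /=; apply/andP; split; apply/eqP; ring.
Qed.

Lemma sin_natpi n : sin (n%:R * (2 * pi)) = 0 :> R.
Proof.
elim: n => [|n IH]; first by rewrite mul0r sin0.
rewrite -natr1 mulrDl mul1r sinD IH mul0r add0r.
by rewrite [2 * pi]mulr_natl sin2pi mulr0.
Qed.
Lemma cos_natpi n : cos (n%:R * (2 * pi)) = 1 :> R.
Proof.
elim: n => [|n IH]; first by rewrite mul0r cos0.
by rewrite -natr1 mulrDl mul1r cosD IH mul1r [2 * pi]mulr_natl cos2pi sin2pi mulr0 subr0.
Qed.

Lemma intT_zpow n : intT (fun z : T => (z : C) ^+ n.+1) = 0.
Proof.
pose a : R := n.+1%:R * (2 * pi).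
have a0 : a != 0 by rewrite !mulf_neq0 ?pnatr_eq0 // gt_eqF // pi_gt0.
have da (x : R) : is_derive x 1 (fun t : R => a * t) a.
  have := @is_deriveZ _ _ _ id a x 1 1 (is_derive_id x 1).
  by rewrite [_ *: _]mulr1.
have ca : continuous (fun t : R => a * t) by exact: mulrl_continuous.
have dS (x : R) : is_derive x 1 (fun t : R => a^-1 * sin (a * t)) (cos (a * x)).
  have := is_derive1_comp (is_derive_sin (a * x)) (da x).
  move/(is_deriveZ a^-1); congr is_derive.
  by rewrite /GRing.scale /= mulrCA mulVf // mulr1.
have dC (x : R) : is_derive x 1 (fun t : R => - a^-1 * cos (a * t)) (sin (a * x)).
  have := is_derive1_comp (is_derive_cos (a * x)) (da x).
  move/(is_deriveZ (- a^-1)); congr is_derive.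
  by rewrite /GRing.scale /= !mulNr !mulrN opprK mulrCA mulVf // mulr1.
have cC : continuous (fun t : R => cos (a * t)).
  by move=> x; apply: (continuous_comp (ca x)); exact: continuous_cos.
have cS : continuous (fun t : R => sin (a * t)).
  by move=> x; apply: (continuous_comp (ca x)); exact: continuous_sin.
apply/eqP; rewrite eq_complex /=; apply/andP; split; apply/eqP.
  transitivity (\int[mu]_(t in I) cos (a * t)).
    by apply: eq_Rintegral => t _; rewrite expi_pow /= mulrA.
  by rewrite (Rintegral_derive dS cC) mulr1 mulr0 sin_natpi sin0 subrr.
transitivity (\int[mu]_(t in I) sin (a * t)).
  by apply: eq_Rintegral => t _; rewrite expi_pow /= mulrA.
by rewrite (Rintegral_derive dC cS) mulr1 mulr0 cos_natpi cos0 subrr.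
Qed.

Lemma fourier_inner f (n : int) : fourier f n = inner f (fun z => (z : C) ^ n).
Proof.
congr intT; apply/funext => z; congr (_ * _).
by rewrite rmorphXz /= ?circle_conjV ?exprz_inv // unitfE circle_neq0.
Qed.

Lemma L2_zpow (n : int) : L2 (fun z : T => (z : C) ^ n).
Proof. exact/multiplier_L2/multiplier_zpow. Qed.

Lemma H2P f : H2 f <-> L2 f /\ forall n, intT (fun z => f z * (z : C) ^+ n.+1) = 0.
Proof. by split => -[lf h]; split => // n; have := h n; rewrite /fourier opprK. Qed.

(** Each Fourier coefficient is a scalar product, hence continuous. *)
Lemma H2_closed : closed_subspace (@H2 R).
Proof.
have L2H f : H2 f -> L2 f by case.
split=> //.
- apply/H2P; split; first exact: L2_cst.
  move=> n; rewrite -[RHS](mul0r (intT (fun z : T => (z : C) ^+ n.+1))) -intT_scale //.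
  by apply: L2_L1; exact: (L2_zpow n.+1).
- move=> w f g [lf hf] [lg hg]; split; first by apply: L2_add => //; exact: L2_scale.
  move=> n; rewrite fourier_inner inner_addl ?inner_scalel -?fourier_inner ?hf ?hg ?mulr0 ?addr0 //.
    exact: L2_zpow.
  + exact: L2_scale.
  + exact: L2_zpow.
- move=> k g M hk lg hM; split=> // n; rewrite fourier_inner.
  set e := fun z => _; have le : L2 e by exact: L2_zpow.
  have lgk m : L2 (fun z => g z - k m z) by apply: L2_sub => //; case: (hk m).
  have gkE m : inner (fun z => g z - k m z) e = inner g e.
    rewrite inner_subl //; last by case: (hk m).
    by rewrite -[inner (k m) e]fourier_inner (hk m).2 subr0.
  have key w : 2 * Re (w * inner g e) <= 0.
    apply: (@le_of_geometric _ _ _ (M + sqnorm (fun z => w^* * e z))) => m.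
    have := Re_inner_geometric m lgk (L2_scale w^* le) hM.
    by rewrite inner_scaler // conjCK gkE add0r.
  apply: sqabs_eq0; apply: le_anti; rewrite sqabs_ge0 andbT.
  have := key (inner g e)^*; rewrite [_^* * _]mulrC mul_conj_sqabs /=; lra.
Qed.

Lemma H2_L2 f : H2 f -> L2 f. Proof. by case. Qed.
Lemma H2_meas f : H2 f -> measurable_circle f. Proof. by move/H2_L2/L2_meas. Qed.
Lemma H2_eq f g : measurable_circle g -> eqT f g -> H2 f -> H2 g.
Proof.
move=> mg fg [lf hf]; split; first exact: L2_eq fg lf.
move=> n; rewrite -(hf n); apply: intT_eq; last by apply: (eqT1 fg) => z ->.
  by apply: measurable_circleM => //; apply: L2_meas; exact: L2_zpow.
by apply: measurable_circleM; [exact: L2_meas|apply: L2_meas; exact: L2_zpow].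
Qed.
Lemma H2_scale w f : H2 f -> H2 (fun z => w * f z).
Proof.
case: H2_closed => _ K0 Kl _ hf; have := Kl w _ _ K0 hf.
by congr H2; apply/funext => z; rewrite add0r.
Qed.
Lemma H2_add f g : H2 f -> H2 g -> H2 (fun z => f z + g z).
Proof.
case: H2_closed => _ K0 Kl _ hf hg; have := Kl 1 _ _ hf hg.
by congr H2; apply/funext => z; rewrite mul1r.
Qed.
Lemma H2_opp f : H2 f -> H2 (fun z => - f z).
Proof. by move/(H2_scale (-1)); congr H2; apply/funext => z; rewrite mulN1r. Qed.
Lemma H2_sub f g : H2 f -> H2 g -> H2 (fun z => f z - g z).
Proof. by move=> hf /H2_opp; exact: H2_add. Qed.
Lemma H2_cst w : H2 (fun=> w).
Proof.
apply/H2P; split; first exact: L2_cst.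
by move=> n; rewrite intT_scale ?intT_zpow ?mulr0 //; apply: L2_L1; exact: (L2_zpow n.+1).
Qed.
Lemma H2_shift f : H2 f -> H2 (fun z => (z : C) * f z).
Proof.
move/H2P => [lf h]; apply/H2P; split; first exact: multiplier_id.
move=> n; rewrite -[RHS](h n.+1); congr intT; apply/funext => z; rewrite (exprS _ n.+1); ring.
Qed.
Lemma H2_shiftn f n : H2 f -> H2 (fun z => (z : C) ^+ n * f z).
Proof.
move=> hf; elim: n => [|n IH].
  by move: hf; congr H2; apply/funext => z; rewrite expr0 mul1r.
by have := H2_shift IH; congr H2; apply/funext => z; rewrite exprS mulrA.
Qed.

Lemma H2_zpow n : H2 (fun z : T => (z : C) ^+ n).
Proof.
by have := H2_shiftn n (H2_cst 1); congr H2; apply/funext => z; rewrite mulr1.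
Qed.

(** The backward shift, which maps f to (f - f(0)) / z. *)
Definition bshift f : T -> C := fun z => (z : C)^* * (f z - intT f).

Lemma multiplier_zbar : multiplier (fun z : T => (z : C)^*). Proof. exact/multiplier_conj/multiplier_id. Qed.

Lemma H2_bshift f : H2 f -> H2 (bshift f).
Proof.
move=> hf; have hd := H2_sub hf (H2_cst (intT f)).
apply/H2P; split; first by apply: multiplier_zbar; exact: H2_L2.
have [lf /= h] := (H2P _).1 hd.
move=> [|n].
  transitivity (intT (fun z => f z + (- intT f))).
    by congr intT; apply/funext => z; rewrite /bshift circle_conjV expr1 mulrC mulVKf ?circle_neq0.
  rewrite intT_add ?intT_cst ?subrr //; apply: L2_L1; [exact: H2_L2|exact: L2_cst].
rewrite -[RHS](h n); congr intT; apply/funext => z.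
by rewrite /bshift circle_conjV [in LHS]exprS mulrACA mulVf ?circle_neq0 // mul1r.
Qed.

(** The projection of f onto H2 has the same nonnegative coefficients as f, all
    zero, so it vanishes by uniqueness of Fourier coefficients, and f is
    orthogonal to H2. *)
Lemma inner_antianalytic f h : L2 f -> (forall n : nat, fourier f n = 0) -> H2 h -> inner f h = 0.
Proof.
move=> lf f0 hh; have [g [hg og]] := projection_exists H2_closed lf.
have lg := H2_L2 hg; have lh := H2_L2 hh.
have g0 : eqT g (fun=> 0).
  apply: fourier_null_eq0; split => // -[n|n]; last by rewrite NegzE; case: hg.
  have hz := H2_zpow n.
  have := og _ hz; rewrite inner_subl //; last exact: H2_L2.
  have := f0 n; rewrite !fourier_inner => -> /eqP.
  by rewrite sub0r oppr_eq0 => /eqP.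
have := og _ hh; rewrite inner_subl // => /eqP; rewrite subr_eq0 => /eqP ->.
rewrite (@inner_eq _ g h (fun=> 0) h); first last.
- exact: eqT_refl.
- exact: g0.
- exact: L2_meas.
- exact: measurable_circle_cst.
- exact: L2_meas.
- exact: L2_meas.
rewrite -[RHS](mul0r (inner (fun=> 0) h)) -inner_scalel //; last exact: L2_cst.
by congr inner; apply/funext => z; rewrite mul0r.
Qed.

(** The conjugate of z g has only negative frequencies, so it is orthogonal
    to f. This identity is the source of all products and of all
    orthogonality relations in H2 used below. *)
Lemma intT_analytic f g : H2 f -> H2 g -> intT (fun z => (z : C) * f z * g z) = 0.
Proof.
move=> hf hg; have lf := H2_L2 hf; have lg := H2_L2 hg.
have lz := multiplier_id lg.
have h0 : inner (fun z => ((z : C) * g z)^*) f = 0.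
  apply: inner_antianalytic => //; first exact: L2_conj.
  move=> n; rewrite /fourier -[RHS]conjC0 -[in RHS](((H2P _).1 hg).2 n) -intT_conj.
    congr intT; apply/funext => z; rewrite !rmorphM rmorphXn /= circle_conjV exprS exprVn exprnN.
    by rewrite -[_ ^ (- _)]exprnN; ring.
  exact: (@fourier_L2 _ g (- n.+1%:Z)).
apply: (can_inj conjCK); rewrite conjC0 -h0 -intT_conj.
  by congr intT; apply/funext => z; rewrite !rmorphM /= ; ring.
have := L2_mul lf lz; congr L1; apply/funext => z; ring.
Qed.

Lemma norm1_conj w : `|w| = 1 -> w^* = w^-1.
Proof.
move=> w1; have w0 : w != 0 by rewrite -normr_gt0 w1 ltr01.
by apply: (mulfI w0); rewrite divff // -normCK w1 expr1n.
Qed.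
Lemma norm1_neq0 w : `|w| = 1 -> w != 0.
Proof. by move=> w1; rewrite -normr_gt0 w1 ltr01. Qed.

Lemma H2_mul f g : H2 f -> H2 g -> L2 (fun z => f z * g z) -> H2 (fun z => f z * g z).
Proof.
move=> hf hg lfg; apply/H2P; split=> // n.
rewrite -[RHS](intT_analytic hf (H2_shiftn n hg)); congr intT; apply/funext => z.
rewrite exprS; ring.
Qed.

(** The value at 0 is multiplicative: write f = f(0) + z (bshift f). *)
Lemma intT_mul f g : H2 f -> H2 g -> intT (fun z => f z * g z) = intT f * intT g.
Proof.
move=> hf hg; have lg := H2_L2 hg.
transitivity (intT (fun z => (z : C) * bshift f z * g z + intT f * g z)).
  congr intT; apply/funext => z; rewrite /bshift circle_conjV mulVKf ?circle_neq0 //; ring.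
rewrite intT_add ?intT_scale ?intT_analytic ?add0r //.
- exact: H2_bshift.
- exact: L2_L1.
- by apply: L2_mul => //; apply: multiplier_id; apply: H2_L2; exact: H2_bshift.
- by apply: L1_scale; exact: L2_L1.
Qed.

Lemma intT_shift f : H2 f -> intT (fun z => (z : C) * f z) = 0.
Proof.
move=> hf; rewrite -[RHS](intT_analytic hf (H2_cst 1)); congr intT.
by apply/funext => z; rewrite mulr1.
Qed.

(** Converse of [inner_zH2]: if f is orthogonal to H2, then f = conj (z k) with
    k = conj (z f) in H2. *)
Lemma H2_of_orthogonal f : L2 f -> (forall h, H2 h -> inner f h = 0) ->
  H2 (fun z => ((z : C) * f z)^*).
Proof.
move=> lf of_; apply/H2P; split; first exact/L2_conj/multiplier_id.
move=> n; apply: (can_inj conjCK); rewrite conjC0.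
have hz := H2_zpow n.
rewrite -[RHS](of_ _ hz) -intT_conj.
  congr intT; apply/funext => z.
  rewrite !rmorphM !rmorphXn /= !conjCK circle_conjV exprS mulrA [_ * (z : C)^-1]mulrAC.
  by rewrite mulfV ?circle_neq0 // mul1r.
apply: L2_mul; first exact/L2_conj/multiplier_id.
exact: (L2_zpow n.+1).
Qed.

Lemma disc_eval0 f : disc_eval f 0 = intT f.
Proof. by congr intT; apply/funext => z; rewrite mul0r subr0 divr1. Qed.

Lemma inner_zH2 f : H2 f -> forall h, H2 h -> inner (fun z => ((z : C) * f z)^*) h = 0.
Proof.
move=> hf h hh; apply: (can_inj conjCK); rewrite conjC0 -(intT_analytic hf hh) -intT_conj.
  by congr intT; apply/funext => z; rewrite !rmorphM /= !conjCK.
by apply: L2_inner; [apply/L2_conj/multiplier_id; exact: H2_L2|exact: H2_L2].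
Qed.

Section Inner.
Variable (u : T -> C).
Hypothesis iu : is_inner u.

Lemma inner_H2 : H2 u. Proof. by case: iu. Qed.
Lemma inner_norm1 : eqT (fun z => `|u z|) (fun=> 1). Proof. by case: iu. Qed.
Lemma inner_multiplier : multiplier u.
Proof. by apply: multiplier_norm1 inner_norm1; exact: H2_meas inner_H2. Qed.
Lemma H2_inner f : H2 f -> H2 (fun z => u z * f z).
Proof. by move=> hf; apply: H2_mul => //; [exact: inner_H2|apply: inner_multiplier; exact: H2_L2]. Qed.

(** Orthogonality of f to u H2 means that conj u f is orthogonal to H2, that is,
    that the conjugate of z conj u f, which is C_u f, is in H2. *)
Lemma modelP f : model u f <-> H2 f /\ H2 (conjugation u f).
Proof.
split=> -[hf h]; split=> //.
  have lf : L2 (fun z => (u z)^* * f z) by apply: multiplier_conj; [exact: inner_multiplier|exact: H2_L2].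
  have := @H2_of_orthogonal _ lf; rewrite (_ : (fun z : T => ((z : C) * _)^*) = conjugation u f).
    apply=> g hg; rewrite -[RHS](h g hg); congr intT; apply/funext => z.
    rewrite !rmorphM /=; ring.
  by apply/funext => z; rewrite /conjugation !rmorphM /= conjCK; ring.
move=> g hg; rewrite /inner; apply: (can_inj conjCK); rewrite conjC0.
rewrite -(intT_analytic h hg) -intT_conj.
  congr intT; apply/funext => z; rewrite /conjugation !rmorphM /= !conjCK circle_conjV.
  by field; rewrite circle_neq0.
by apply: L2_inner; [exact: H2_L2|apply: inner_multiplier; exact: H2_L2].
Qed.

Lemma model_H2 f : model u f -> H2 f. Proof. by case. Qed.
Lemma model_L2 f : model u f -> L2 f. Proof. by case=> /H2_L2. Qed.
Lemma model_conjugation_H2 f : model u f -> H2 (conjugation u f).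
Proof. by move/modelP => []. Qed.

Lemma measurable_circle_conjugation f : measurable_circle f -> measurable_circle (conjugation u f).
Proof.
move=> mf; apply: measurable_circleM; first exact: H2_meas inner_H2.
by apply: measurable_circle_conj; apply: measurable_circleM => //; exact: measurable_circle_id.
Qed.

Lemma model_eq f g : measurable_circle g -> eqT f g -> model u f -> model u g.
Proof.
move=> mg fg /modelP[hf hc]; apply/modelP; split; first exact: H2_eq fg hf.
by apply: H2_eq hc; [exact: measurable_circle_conjugation|apply: (eqT1 fg) => z; rewrite /conjugation => ->].
Qed.
Lemma model_add f g : model u f -> model u g -> model u (fun z => f z + g z).
Proof.
move=> [hf of_] [hg og]; split; first exact: H2_add.
move=> h hh; rewrite inner_addl ?of_ ?og ?addr0 //; try exact: H2_L2.
by apply: inner_multiplier; exact: H2_L2.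
Qed.
Lemma model_scale w f : model u f -> model u (fun z => w * f z).
Proof.
move=> [hf of_]; split; first exact: H2_scale.
move=> h hh; rewrite inner_scalel ?of_ ?mulr0 //; try exact: H2_L2.
by apply: inner_multiplier; exact: H2_L2.
Qed.
Lemma model_opp f : model u f -> model u (fun z => - f z).
Proof. by move/(model_scale (-1)); congr (model u); apply/funext => z; rewrite mulN1r. Qed.
Lemma model_sub f g : model u f -> model u g -> model u (fun z => f z - g z).
Proof. by move=> mf /model_opp; exact: model_add. Qed.

Lemma conjugationK f : eqT (conjugation u (conjugation u f)) f.
Proof.
apply: (eqT1 inner_norm1) => z u1; rewrite /conjugation !rmorphM /= !conjCK circle_conjV norm1_conj //.
by field; rewrite circle_neq0 norm1_neq0.
Qed.

Lemma model_conjugation f : model u f -> model u (conjugation u f).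
Proof.
move=> mf; apply/modelP; split; first exact: model_conjugation_H2.
by apply: H2_eq (eqT_sym (conjugationK f)) (model_H2 mf);
   do 2 apply: measurable_circle_conjugation; exact/L2_meas/model_L2.
Qed.

Lemma model_k0 : model u (k0 u).
Proof.
apply/modelP; split.
  by rewrite /k0; apply: H2_sub; [exact: H2_cst|apply: H2_scale; exact: inner_H2].
apply: H2_eq (H2_bshift inner_H2).
  apply: measurable_circle_conjugation; apply: L2_meas; apply: L2_sub; first exact: L2_cst.
  by apply: L2_scale; exact: H2_L2 inner_H2.
apply: (eqT1 inner_norm1) => z u1.
rewrite /conjugation /k0 /bshift disc_eval0.
rewrite !(rmorphM, rmorphB, rmorph1) /= !conjCK circle_conjV norm1_conj //.
by field; rewrite circle_neq0 norm1_neq0.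
Qed.
Lemma intT_k0E : intT (k0 u) = 1 - (intT u)^* * intT u.
Proof.
rewrite /k0 disc_eval0; have lu := L2_L1 (H2_L2 inner_H2).
have -> : (fun z => 1 - (intT u)^* * u z) = (fun z => 1 + (- (intT u)^*) * u z).
  by apply/funext => z; rewrite mulNr.
by rewrite intT_add ?intT_scale ?intT_cst ?mulNr //; [exact/L2_L1/L2_cst|exact: L1_scale].
Qed.
Lemma k0tE : k0t u = bshift u.
Proof. by apply/funext => z; rewrite /k0t /bshift disc_eval0. Qed.
Lemma conjugation_k0t : eqT (conjugation u (k0t u)) (k0 u).
Proof.
apply: (eqT1 inner_norm1) => z u1.
rewrite /conjugation k0tE /k0 /bshift disc_eval0.
rewrite !(rmorphM, rmorphB, rmorph1) /= !conjCK circle_conjV norm1_conj //.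
by field; rewrite circle_neq0 norm1_neq0.
Qed.
(** C_u exchanges the backward shift with the shift compressed to K_u: the
    constant conj (f(0)) is the one for which z C_u f minus a multiple of u
    is orthogonal to u. *)
Lemma conjugation_bshift f : eqT (conjugation u (bshift f))
  (fun z => (z : C) * conjugation u f z - (intT f)^* * u z).
Proof.
apply: (eqT1 (eqT_refl f)) => z _.
rewrite /conjugation /bshift !(rmorphM, rmorphB, rmorph1) /= !conjCK circle_conjV.
by field; rewrite circle_neq0.
Qed.
Lemma model_bshift f : model u f -> model u (bshift f).
Proof.
move=> mf; have hb := H2_bshift (model_H2 mf); apply/modelP; split => //.
apply: H2_eq (eqT_sym (conjugation_bshift f)) _.
  by apply: measurable_circle_conjugation; exact: H2_meas.
apply: H2_sub; first by apply: H2_shift; exact: model_conjugation_H2.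
by apply: H2_scale; exact: inner_H2.
Qed.
Lemma model_k0t : model u (k0t u).
Proof.
apply/modelP; rewrite k0tE; have hb := H2_bshift inner_H2; split => //.
rewrite -k0tE; apply: H2_eq (eqT_sym conjugation_k0t) (model_H2 model_k0).
by rewrite k0tE; apply: measurable_circle_conjugation; exact: H2_meas.
Qed.

Lemma sqnorm_eq0 f : L2 f -> sqnorm f = 0 -> eqT f (fun=> 0).
Proof.
move=> lf; rewrite /sqnorm /Rintegral => n0.
have fin : (\int[mu]_(t in I) (sqabs (f (expi t)))%:E)%E \is a fin_num.
  by apply: integrable_fin_num => //; case: lf.
have i0 : (\int[mu]_(t in I) `|(sqabs (f (expi t)))%:E|)%E = 0%E.
  under eq_integral do rewrite gee0_abs ?lee_fin ?sqabs_ge0 //.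
  by rewrite -(fineK fin); congr EFin.
have ms : measurable_fun I (fun t => (sqabs (f (expi t)))%:E).
  by apply/measurable_EFinP; apply: measurable_sqabs; exact: L2_meas.
have /(_ i0) := (ae_eq_integral_abs mu measurable_itv01 ms).1.
by apply: filterS => t /= e It; apply: sqabs_eq0; have [] := e It.
Qed.

Lemma is_proj_unique f g g' : L2 f -> is_proj (model u) f g -> is_proj (model u) f g' -> eqT g g'.
Proof.
move=> lf [mg og] [mg' og']; have lg := model_L2 mg; have lg' := model_L2 mg'.
have md := model_sub mg mg'; have ld := model_L2 md.
have : inner (fun z => g z - g' z) (fun z => g z - g' z) = 0.
  have := og _ md; rewrite inner_subl // => /eqP; rewrite subr_eq0 => /eqP e.
  by have := og' _ md; rewrite inner_subl // e -inner_subl.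
rewrite inner_self => -[n0]; have := sqnorm_eq0 ld n0.
by move=> d0; apply: (eqT1 d0) => z /eqP; rewrite subr_eq0 => /eqP.
Qed.

Lemma inner_uH2 f h : model u f -> H2 h -> inner (fun z => u z * h z) f = 0.
Proof.
move=> mf hh; rewrite (inner_conj (model_L2 mf)) ?mf.2 ?conjC0 //.
by apply: inner_multiplier; exact: H2_L2.
Qed.

(** The summands u h and conj (z k) are orthogonal to K_u. This is the tool by
    which all projections are identified. *)
Lemma is_proj_decomp f g h k : measurable_circle f -> model u g -> H2 h -> H2 k ->
  eqT f (fun z => g z + u z * h z + ((z : C) * k z)^*) -> is_proj (model u) f g.
Proof.
move=> mf mg hh hk fE; split=> // e me.
have luh : L2 (fun z => u z * h z) by apply: inner_multiplier; exact: H2_L2.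
have lzk : L2 (fun z => ((z : C) * k z)^*) by apply: L2_conj; apply: multiplier_id; exact: H2_L2.
have lf : L2 f.
  apply: L2_eq (eqT_sym fE) _ => //.
  by apply: L2_add => //; apply: L2_add => //; exact: model_L2.
rewrite (@inner_eq _ _ e (fun z => u z * h z + ((z : C) * k z)^*) e).
- rewrite inner_addl //; last exact: model_L2.
  by rewrite inner_uH2 // inner_zH2 ?addr0 //; exact: model_H2.
- by apply: L2_meas; apply: L2_sub => //; exact: model_L2.
- exact/L2_meas/model_L2.
- by apply: L2_meas; exact: L2_add.
- exact/L2_meas/model_L2.
- by apply: (eqT1 fE) => z ->; ring.
- exact: eqT_refl.
Qed.

(** Take for h the projection of conj u f onto H2. *)
Lemma H2_decomp f : H2 f -> exists2 h, H2 h & model u (fun z => f z - u z * h z).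
Proof.
move=> hf; have lf := H2_L2 hf.
have luf : L2 (fun z => (u z)^* * f z) by apply: multiplier_conj; [exact: inner_multiplier|].
have [h [hh oh]] := projection_exists H2_closed luf.
have lh := H2_L2 hh; have luh := inner_multiplier lh.
exists h => //; split; first by apply: H2_sub => //; exact: H2_inner.
move=> g hg; rewrite -[RHS](oh g hg); apply: intT_eq.
- apply: measurable_circleM; first by apply: L2_meas; exact: L2_sub.
  by apply: measurable_circle_conj; apply: L2_meas; apply: inner_multiplier; exact: H2_L2.
- apply: measurable_circleM; first by apply: L2_meas; exact: L2_sub.
  by apply: measurable_circle_conj; exact: H2_meas.
apply: (eqT1 inner_norm1) => z u1; rewrite rmorphM /= norm1_conj //.
by field; rewrite norm1_neq0.
Qed.

Lemma L2_decomp f : L2 f -> exists g h k, [/\ model u g, H2 h, H2 k &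
  f = (fun z => g z + u z * h z + ((z : C) * k z)^*)].
Proof.
move=> lf; have [f1 [hf1 o1]] := projection_exists H2_closed lf.
have lf1 := H2_L2 hf1.
have hk := H2_of_orthogonal (L2_sub lf lf1) o1.
have [h hh mg] := H2_decomp hf1.
exists (fun z => f1 z - u z * h z), h; eexists; split; [by []|by []|exact: hk|].
apply/funext => z; rewrite /= !rmorphM /= !conjCK circle_conjV.
by field; rewrite circle_neq0.
Qed.

Lemma is_proj_exists f : L2 f -> exists g, is_proj (model u) f g.
Proof.
move=> lf; have [g [h [k [mg hh hk fE]]]] := L2_decomp lf.
by exists g; apply: is_proj_decomp mg hh hk _; [exact: L2_meas|rewrite fE; exact: eqT_refl].
Qed.

(** By induction on n: z conj v = conj (bshift v) + conj (v(0)) z. Each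
    step multiplies by z or conj z and adds constants, so that multipliers are
    preserved. *)
Lemma conj_inner_zpow n : exists p v, [/\ H2 p, multiplier p, H2 v, multiplier v &
  forall z, (u z)^* * (z : C) ^+ n = p z + (v z)^*].
Proof.
elim: n => [|n [p [v [hp mp hv mv e]]]].
  exists (fun=> 0), u; split; [exact: H2_cst|exact: multiplier_cst|exact: inner_H2|exact: inner_multiplier|].
  by move=> z; rewrite expr0 mulr1 add0r.
exists (fun z : T => (z : C) * p z + (intT v)^* * (z : C)), (bshift v); split.
- apply: H2_add; first exact: H2_shift.
  apply: H2_scale; have := H2_shift (H2_cst 1); congr H2; apply/funext => z; exact: mulr1.
- apply: multiplier_add; first by apply: multiplier_mul => //; exact: multiplier_id.
  by apply: multiplier_mul; [exact: multiplier_cst|exact: multiplier_id].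
- exact: H2_bshift.
- apply: multiplier_mul; first exact: multiplier_zbar.
  by apply: multiplier_sub => //; exact: multiplier_cst.
move=> z; rewrite exprS mulrCA e /bshift !(rmorphM, rmorphB) /= conjCK; ring.
Qed.

(** The projection of z^n onto K_u is z^n - u g, where g is the analytic part of
    conj u z^n; by [conj_inner_zpow] it is a multiplier. A vector of K_u
    orthogonal to it is orthogonal to z^n. *)
Lemma model_multiplier_total f : model u f ->
  (forall e, model u e -> multiplier e -> inner f e = 0) -> eqT f (fun=> 0).
Proof.
move=> mf h; have lf := model_L2 mf; apply: fourier_null_eq0; split=> // -[n|n]; last first.
  by rewrite NegzE; case: mf => -[_ ->].
have [p [v [hp mp hv mv e]]] := conj_inner_zpow n.
pose q z := p z + (intT v)^*.
have hq : H2 q by apply: H2_add => //; exact: H2_cst.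
have mq : multiplier q by apply: multiplier_add => //; exact: multiplier_cst.
have hz := H2_zpow n.
have mz : multiplier (fun z : T => (z : C) ^+ n) by exact/multiplier_exp/multiplier_id.
pose d (z : T) := (z : C) ^+ n - u z * q z.
have md : multiplier d by apply: multiplier_sub => //; apply: multiplier_mul => //; exact: inner_multiplier.
have Kd : model u d.
  have hd : H2 d by apply: H2_sub => //; exact: H2_inner.
  apply/modelP; split=> //; apply: H2_eq (H2_bshift hv).
    by apply: measurable_circle_conjugation; exact: H2_meas.
  apply: (eqT1 inner_norm1) => z u1.
  have dz : d z = u z * (v z - intT v)^*.
    rewrite /d /q rmorphB /=.
    have -> : (z : C) ^+ n = u z * ((u z)^* * (z : C) ^+ n).
      by rewrite norm1_conj // mulVKf ?norm1_neq0.
    rewrite e; ring.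
  rewrite /conjugation dz /bshift !rmorphM /= conjCK (norm1_conj u1).
  by rewrite [RHS]mulrCA mulVKf ?norm1_neq0.
have := h d Kd md; rewrite /d inner_subr //; last 2 first.
- exact: H2_L2.
- by apply: inner_multiplier; exact: H2_L2.
by rewrite fourier_inner mf.2 // subr0.
Qed.

End Inner.
End Hardy.

(** * Symbols of truncated Toeplitz operators *)

Section Operators.
Context {R : realType}.
Local Notation C := R[i].
Local Notation T := (circle R).
Implicit Types (f g h e u phi psi chi : T -> C) (w : C).

Lemma is_proj_congr u f f' g g' : is_inner u -> measurable_circle f -> measurable_circle f' ->
  model u g' -> eqT f f' -> eqT g g' -> is_proj (model u) f g -> is_proj (model u) f' g'.
Proof.
move=> iu mf mf' mg' ff' gg' [mg og]; split=> // e me; rewrite -(og e me); apply: inner_eq.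
- by apply: measurable_circleD => //; apply: L2_meas; apply: L2_opp; exact: model_L2 mg'.
- exact/L2_meas/(model_L2 me).
- by apply: measurable_circleD => //; apply: L2_meas; apply: L2_opp; exact: model_L2 mg.
- exact/L2_meas/(model_L2 me).
- by apply: (eqT2 ff' gg') => z -> ->.
- exact: eqT_refl.
Qed.

Lemma inner_move phi f e : inner (fun z => phi z * f z) e = inner f (fun z => (phi z)^* * e z).
Proof.
congr intT; apply/funext => z; rewrite rmorphM /= conjCK; ring.
Qed.

(** This number is the squared distance in L2 from u to the constant u(0). *)
Lemma one_sub_norm_value u : is_inner u -> nonconstant u -> 1 - (intT u)^* * intT u != 0.
Proof.
move=> iu ncu; apply/negP => /eqP e0; apply: ncu; exists (intT u).
have lu := H2_L2 (inner_H2 iu); have lc := L2_cst (R := R) (intT u).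
have ld := L2_sub lu lc.
have i1 : inner u u = 1.
  rewrite -[RHS]intT_cst; apply: intT_eq.
  - by apply: measurable_circleM; [exact: L2_meas|apply: measurable_circle_conj; exact: L2_meas].
  - exact: measurable_circle_cst.
  by apply: (eqT1 (inner_norm1 iu)) => z u1; rewrite norm1_conj // mulfV ?norm1_neq0.
have i2 : inner u (fun=> intT u) = (intT u)^* * intT u.
  rewrite -intT_scale; last exact: L2_L1.
  by congr intT; apply/funext => z; rewrite mulrC.
have i3 : inner (fun=> intT u) u = (intT u)^* * intT u.
  by rewrite (inner_conj lu lc) i2 rmorphM /= conjCK mulrC.
have i4 : inner (fun=> intT u) (fun=> intT u) = (intT u)^* * intT u.
  by rewrite /inner intT_cst mulrC.
have : inner (fun z => u z - intT u) (fun z => u z - intT u) = 0.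
  by rewrite inner_subl // !inner_subr // i1 i2 i3 i4 e0; ring.
rewrite inner_self => -[n0]; apply: (eqT1 (sqnorm_eq0 ld n0)) => z /eqP.
by rewrite subr_eq0 => /eqP.
Qed.

Section Symbols.
Variables (alpha theta : T -> C) (A As : (T -> C) -> (T -> C)).
Hypotheses (ia : is_inner alpha) (it : is_inner theta).
Hypothesis adj : is_adjoint (model theta) (model alpha) A As.

(** On multipliers every product with phi is square integrable, so this
    relation, unlike [tto], has no domain depending on phi. *)
Definition weak_symbol phi : Prop :=
  [/\ L2 phi, bounded_op (model theta) (model alpha) A &
   forall f e, model theta f -> multiplier f -> model alpha e -> multiplier e ->
     inner (A f) e = inner (fun z => phi z * f z) e].

Lemma weak_symbol_of_tto phi : tto theta alpha phi A -> weak_symbol phi.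
Proof.
move=> [lphi bA h]; split=> // f e mf uf me ue.
have lpf : L2 (fun z => phi z * f z).
  by have := uf _ lphi; congr L2; apply/funext => z; rewrite mulrC.
have [mA o] := h f mf lpf.
have lA := model_L2 mA; have le := model_L2 me.
have := o e me; rewrite inner_subl //.
by move/eqP; rewrite subr_eq0 => /eqP.
Qed.

(** Both sides have the same scalar products with the multipliers of K_theta,
    which are total. *)
Lemma adjoint_proj phi e : weak_symbol phi -> model alpha e -> multiplier e ->
  is_proj (model theta) (fun z => (phi z)^* * e z) (As e).
Proof.
move=> [lphi bA h] me ue.
have lpe : L2 (fun z => (phi z)^* * e z).
  by have := ue _ (L2_conj lphi); congr L2; apply/funext => z; rewrite mulrC.
have mG : model theta (As e) by case: adj => -[hB _ _] _; exact: hB.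
have [G' [mG' oG']] := is_proj_exists it lpe.
have mD := model_sub it mG mG'.
apply: (@is_proj_congr _ (fun z => (phi z)^* * e z) _ G') => //; try exact: L2_meas.
  exact: eqT_refl.
have d0 : eqT (fun z => As e z - G' z) (fun=> 0).
  apply: (model_multiplier_total it mD) => f mf uf.
  have lG := model_L2 mG; have lG' := model_L2 mG'; have lf := model_L2 mf.
  rewrite inner_subl //.
  have -> : inner (As e) f = inner (fun z => (phi z)^* * e z) f.
    by rewrite (inner_conj lf lG) -adj.2 // h // inner_move -inner_conj.
  by rewrite -inner_subl // oG'.
by apply: (eqT1 d0) => z /eqP; rewrite subr_eq0 => /eqP.
Qed.

(** For e a multiplier in K_alpha, A^* e is the projection of conj phi e, hence
    the scalar products of A f and of P_alpha (phi f) with e are equal for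
    every f of the domain, and not only for multipliers f. *)
Lemma tto_of_weak_symbol phi : weak_symbol phi -> tto theta alpha phi A.
Proof.
move=> sy; have [lphi bA h] := sy; split=> // f mf lpf.
have [F [mF oF]] := is_proj_exists ia lpf.
have mA : model alpha (A f) by case: bA => hB _ _; exact: hB.
apply: (@is_proj_congr _ (fun z => phi z * f z) _ F) => //; try exact: L2_meas.
  exact: eqT_refl.
have mD := model_sub ia mF mA.
have d0 : eqT (fun z => F z - A f z) (fun=> 0).
  apply: (model_multiplier_total ia mD) => e me ue.
  have [mG oG] := adjoint_proj sy me ue.
  have lpe : L2 (fun z => (phi z)^* * e z).
    by have := ue _ (L2_conj lphi); congr L2; apply/funext => z; rewrite mulrC.
  have le := model_L2 me; have lf := model_L2 mf; have lG := model_L2 mG.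
  have lF := model_L2 mF; have lA := model_L2 mA.
  rewrite inner_subl // adj.2 //.
  have -> : inner F e = inner (fun z => phi z * f z) e.
    have := oF e me; rewrite inner_subl // => /eqP.
    by rewrite subr_eq0 => /eqP ->.
  have := oG f mf; rewrite inner_subl // => /eqP; rewrite subr_eq0 => /eqP E.
  by rewrite inner_move (inner_conj lpe lf) E -inner_conj // subrr.
by apply: (eqT1 d0) => z /eqP; rewrite subr_eq0 => /eqP.
Qed.

(** Symbols in alpha H2 + conj (theta H2) represent the zero operator. *)
Lemma weak_symbol_modulo phi phi' h k : weak_symbol phi -> L2 phi' -> H2 h -> H2 k ->
  phi = (fun z => phi' z + alpha z * h z + (theta z * k z)^*) -> weak_symbol phi'.
Proof.
move=> [lphi bA hA] lphi' hh hk phiE; split=> // f e mf uf me ue.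
have lh := H2_L2 hh; have lk := H2_L2 hk; have le := model_L2 me; have lf := model_L2 mf.
have ltk : L2 (fun z => (theta z * k z)^*) by apply: L2_conj; exact: inner_multiplier.
have mul_f g : L2 g -> L2 (fun z => g z * f z).
  by move/uf; congr L2; apply/funext => z; rewrite mulrC.
have hhf : H2 (fun z => h z * f z) by apply: H2_mul => //; [exact: model_H2 mf|exact: mul_f].
have hke : H2 (fun z => k z * e z).
  apply: H2_mul => //; first exact: model_H2 me.
  by have := ue _ lk; congr L2; apply/funext => z; rewrite mulrC.
rewrite hA // phiE.
have -> : (fun z => (phi' z + alpha z * h z + (theta z * k z)^*) * f z) =
  (fun z => (phi' z * f z + alpha z * (h z * f z)) + (theta z * k z)^* * f z).
  by apply/funext => z; ring.
have l1 := mul_f _ lphi'; have l3 := mul_f _ ltk.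
have l2 : L2 (fun z => alpha z * (h z * f z)) by apply: inner_multiplier => //; exact: H2_L2.
rewrite inner_addl //; last exact: L2_add.
rewrite inner_addl // (inner_uH2 ia me hhf) addr0.
rewrite (@inner_move (fun z => (theta z * k z)^*)).
have -> : (fun z => ((theta z * k z)^*)^* * e z) = (fun z => theta z * (k z * e z)).
  by apply/funext => z; rewrite conjCK mulrA.
by rewrite (mf.2 _ hke) addr0.
Qed.

(** Decompose phi along H2 and its complement, then each part along a model
    space. The constants can be shifted between the two summands because
    k_0^alpha - conj k_0^theta is in alpha H2 + conj (theta H2), and the
    values k_0^alpha(0), k_0^theta(0) are not zero. *)
Lemma symbol_normalised (b : bool) p phi : nonconstant alpha -> nonconstant theta -> L2 phi ->
  exists psi chi h k, [/\ model alpha psi, model theta chi, H2 h /\ H2 k,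
    phi = (fun z => (psi z + (chi z)^*) + alpha z * h z + (theta z * k z)^*) &
    if b then intT psi = p else intT chi = p].
Proof.
move=> na nt lphi.
have [g [h [k [mg hh hk ->]]]] := L2_decomp ia lphi.
have [k' hk' mc] := H2_decomp it (H2_shift hk).
set chi := fun z => _ in mc.
have a0 := one_sub_norm_value ia na; have t0 := one_sub_norm_value it nt.
have ea := intT_k0E ia; have et := intT_k0E it.
have main c : exists psi chi' h1 k1, [/\ model alpha psi, model theta chi', H2 h1 /\ H2 k1,
    (fun z => g z + alpha z * h z + ((z : C) * k z)^*) =
    (fun z => (psi z + (chi' z)^*) + alpha z * h1 z + (theta z * k1 z)^*) &
    intT psi = intT g + c * intT (k0 alpha) /\ intT chi' = intT chi - c^* * intT (k0 theta)].
  exists (fun z => g z + c * k0 alpha z), (fun z => chi z - c^* * k0 theta z).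
  exists (fun z => h z + c * (intT alpha)^*), (fun z => k' z - c^* * (intT theta)^*).
  have mka := model_scale ia c (model_k0 ia); have mkt := model_scale it c^* (model_k0 it).
  split.
  - exact: model_add.
  - exact: model_sub.
  - by split; [apply: H2_add => //|apply: H2_sub => //]; exact: H2_cst.
  - apply/funext => z.
    have -> : (z : C) * k z = chi z + theta z * k' z by rewrite /chi subrK.
    rewrite /k0 !disc_eval0 !(rmorphD, rmorphN, rmorphM, rmorph1) /= !conjCK; ring.
  - have l1 := L2_L1 (model_L2 mka); have l2 := L2_L1 (model_L2 mkt).
    have l3 := L2_L1 (model_L2 (model_k0 ia)); have l4 := L2_L1 (model_L2 (model_k0 it)).
    split; first by rewrite intT_add ?intT_scale //; exact: L2_L1 (model_L2 mg).
    have -> : (fun z => chi z - c^* * k0 theta z) = (fun z => chi z + (- c^*) * k0 theta z).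
      by apply/funext => z; rewrite mulNr.
    rewrite intT_add ?intT_scale ?mulNr //; [exact: L2_L1 (model_L2 mc)|exact: L1_scale].
case: b.
  have [psi [chi' [h' [k1 [m1 m2 m3 m4 [m5 _]]]]]] := main ((p - intT g) / intT (k0 alpha)).
  exists psi, chi', h', k1; split=> //.
  by rewrite m5 divfK ?ea // addrC subrK.
have [psi [chi' [h' [k1 [m1 m2 m3 m4 [_ m5]]]]]] := main ((intT chi - p) / intT (k0 theta))^*.
exists psi, chi', h', k1; split=> //.
by rewrite m5 conjCK divfK ?et // opprB addrC subrK.
Qed.

End Symbols.
End Operators.

(** * Action on the kernels *)

Section Kernels.
Context {R : realType}.
Local Notation C := R[i].
Local Notation T := (circle R).
Implicit Types (f g h e u phi psi chi : T -> C) (w : C).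

Lemma multiplier_k0 u : is_inner u -> multiplier (k0 u).
Proof.
move=> iu; apply: multiplier_sub; first exact: multiplier_cst.
by apply: multiplier_mul; [exact: multiplier_cst|exact: inner_multiplier].
Qed.
Lemma multiplier_k0t u : is_inner u -> multiplier (k0t u).
Proof.
move=> iu; apply: multiplier_mul; first exact: multiplier_zbar.
by apply: multiplier_sub; [exact: inner_multiplier|exact: multiplier_cst].
Qed.

Lemma quoK (theta alpha : T -> C) (z : T) : `|alpha z| = 1 -> theta z = alpha z * quo theta alpha z.
Proof. by move=> a1; rewrite /quo norm1_conj // mulVKf ?norm1_neq0. Qed.

Section Divisor.
Variables (alpha theta : T -> C).
Hypotheses (ia : is_inner alpha) (it : is_inner theta) (iq : divides alpha theta).
Local Notation q := (quo theta alpha).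

Lemma model_quo_mul f : model alpha f -> model theta (fun z => q z * f z).
Proof.
move=> mf; have hqf := H2_inner iq (model_H2 mf).
apply/(modelP it); split=> //; apply: H2_eq (model_conjugation_H2 ia mf).
  by apply: measurable_circle_conjugation => //; exact: H2_meas.
apply: (eqT2 (inner_norm1 ia) (inner_norm1 iq)) => z a1 q1.
rewrite /conjugation (quoK theta a1); move: (quo theta alpha z) q1 => qz q1.
rewrite !rmorphM /= (norm1_conj q1).
by field; rewrite norm1_neq0.
Qed.

Lemma model_quo_sub f : model q f -> model theta f.
Proof.
move=> mf; apply/(modelP it); split; first exact: model_H2 mf.
apply: H2_eq (H2_inner ia (model_conjugation_H2 iq mf)).
  by apply: measurable_circle_conjugation => //; exact/L2_meas/(model_L2 mf).
by apply: (eqT1 (inner_norm1 ia)) => z a1; rewrite /conjugation (quoK theta a1) mulrA.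
Qed.

(** C_q h = C_theta f - q C_alpha (f - alpha h), and both terms are in H2. *)
Lemma model_decomp f : model theta f ->
  exists2 h, model q h & model alpha (fun z => f z - alpha z * h z).
Proof.
move=> mf; have [h hh mh] := H2_decomp ia (model_H2 mf); exists h => //.
apply/(modelP iq); split=> //.
have hc := model_conjugation_H2 it mf; have hm := H2_inner iq (model_conjugation_H2 ia mh).
apply: H2_eq (H2_sub hc hm); first by apply: measurable_circle_conjugation => //; exact: H2_meas.
apply: (eqT1 (inner_norm1 ia)) => z a1.
rewrite /conjugation (quoK theta a1); move: (quo theta alpha z) => qz.
rewrite !(rmorphD, rmorphN, rmorphM) /= (norm1_conj a1).
by field; rewrite norm1_neq0.
Qed.
End Divisor.

Lemma inner_k0 u g : is_inner u -> model u g -> inner g (k0 u) = intT g.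
Proof.
move=> iu mg; have lg := model_L2 mg; have lu := H2_L2 (inner_H2 iu).
rewrite /k0 inner_subr //; [|exact: L2_cst|exact: L2_scale].
rewrite inner_scaler //.
have -> : inner g u = 0.
  by rewrite -(mg.2 _ (H2_cst 1)); congr inner; apply/funext => z; rewrite mulr1.
rewrite mulr0 subr0; congr intT; apply/funext => z; by rewrite rmorph1 mulr1.
Qed.

Lemma inner_k0t u g : is_inner u -> model u g -> inner g (k0t u) = (intT (conjugation u g))^*.
Proof.
move=> iu mg; have lg := model_L2 mg; have lu := H2_L2 (inner_H2 iu).
have lzg := multiplier_id lg.
transitivity (inner (fun z => (z : C) * g z) (fun z => u z - disc_eval u 0)).
  by congr intT; apply/funext => z; rewrite /k0t rmorphM /= conjCK; ring.
rewrite inner_subr //; last exact: L2_cst.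
have -> : inner (fun z => (z : C) * g z) (fun=> disc_eval u 0) = 0.
  transitivity ((disc_eval u 0)^* * intT (fun z => (z : C) * g z)).
    rewrite -intT_scale; last exact: L2_L1.
    by rewrite /inner; congr intT; apply/funext => z; exact: mulrC.
  by rewrite intT_shift ?mulr0 //; exact: model_H2 mg.
rewrite subr0 -intT_conj.
  by congr intT; apply/funext => z; rewrite /conjugation !rmorphM /= !conjCK; exact: mulrC.
by apply: L2_L1; exact: H2_L2 (model_conjugation_H2 iu mg).
Qed.

Lemma intT_bshift_conjugation u f : is_inner u -> model u f ->
  intT (conjugation u (bshift f)) = - (intT f)^* * intT u.
Proof.
move=> iu mf; have hc := model_conjugation_H2 iu mf; have hu := inner_H2 iu.
rewrite (intT_eq _ _ (conjugation_bshift u f)).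
- have -> : (fun z : T => (z : C) * conjugation u f z - (intT f)^* * u z) =
    (fun z : T => (z : C) * conjugation u f z + (- (intT f)^*) * u z).
    by apply/funext => z; rewrite mulNr.
  rewrite intT_add ?intT_scale ?intT_shift ?add0r //; try exact: L2_L1 (H2_L2 hu).
    by apply: L2_L1; apply: multiplier_id; exact: H2_L2.
  by apply: L1_scale; exact: L2_L1 (H2_L2 hu).
- apply: measurable_circle_conjugation => //; apply: H2_meas; exact: H2_bshift (model_H2 mf).
- apply: L2_meas; apply: L2_sub; first by apply: multiplier_id; exact: H2_L2.
  by apply: L2_scale; exact: H2_L2.
Qed.

Section Compute.
Variables (alpha theta : T -> C) (A As : (T -> C) -> (T -> C)).
Hypotheses (ia : is_inner alpha) (it : is_inner theta) (iq : divides alpha theta).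
Hypothesis adj : is_adjoint (model theta) (model alpha) A As.
Local Notation q := (quo theta alpha).
Variables (psi chi h2 : T -> C).
Hypotheses (mpsi : model alpha psi) (mchi : model theta chi).
Hypothesis sy : weak_symbol alpha theta A (fun z => psi z + (chi z)^*).
Let w := conjugation theta chi.
Let h1 z := w z - alpha z * h2 z.
Hypotheses (mh1 : model alpha h1) (mh2 : model q h2).
Let m := conjugation alpha h1.
Let b0 := (intT m)^*.

Let mw : model theta w. Proof. exact: model_conjugation. Qed.
Let mm : model alpha m. Proof. exact: model_conjugation. Qed.

Lemma theta0E : intT theta = intT q * intT alpha.
Proof.
rewrite -(intT_mul (inner_H2 iq) (inner_H2 ia)); apply: intT_eq.
- exact: H2_meas (inner_H2 it).
- by apply: measurable_circleM; apply: H2_meas; [exact: inner_H2 iq|exact: inner_H2 ia].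
by apply: (eqT1 (inner_norm1 ia)) => z a1; rewrite (quoK theta a1) mulrC.
Qed.

(** Applying C_alpha to the backward shift of C_alpha h1 gives this function. *)
Lemma model_zh1 : model alpha (fun z => (z : C) * h1 z - b0 * alpha z).
Proof.
have lh1 := model_L2 mh1.
apply: model_eq (model_conjugation ia (model_bshift ia mm)) => //.
  apply: L2_meas; apply: L2_sub; first exact: multiplier_id.
  by apply: L2_scale; exact: H2_L2 (inner_H2 ia).
apply: (eqT2 (conjugation_bshift alpha m) (conjugationK ia h1)) => z -> e.
by rewrite -e.
Qed.

(** The terms outside alpha H2 + conj (z H2) are found from
    theta conj chi = z C_theta chi = z h1 + alpha z h2 and
    conj chi = conj (chi(0)) + conj (z bshift chi). *)
Lemma tto_k0 : eqT (A (k0 theta))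
  (fun z => psi z + (intT chi)^* * k0 alpha z
            - (intT theta)^* * ((z : C) * h1 z - b0 * alpha z)).
Proof.
have [lphi bA _] := sy; have [_ _ prA] := tto_of_weak_symbol ia it adj sy.
have lf : L2 (fun z => (psi z + (chi z)^*) * k0 theta z).
  by have := multiplier_k0 it lphi; congr L2; apply/funext => z; rewrite mulrC.
apply: (is_proj_unique ia lf (prA _ (model_k0 it) lf)).
have mg := model_sub ia (model_add ia mpsi (model_scale ia (intT chi)^* (model_k0 ia)))
  (model_scale ia (intT theta)^* model_zh1).
pose h z := (intT chi)^* * (intT alpha)^* - (intT theta)^* * (q z * psi z)
  - (intT theta)^* * ((z : C) * h2 z) - (intT theta)^* * b0.
have hh : H2 h.
  apply: H2_sub; last exact: H2_cst; apply: H2_sub; last first.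
    by apply: H2_scale; apply: H2_shift; exact: model_H2 mh2.
  apply: H2_sub; first exact: H2_cst.
  by apply: H2_scale; apply: H2_inner => //; exact: model_H2 mpsi.
apply: (is_proj_decomp ia _ mg hh (H2_bshift (model_H2 mchi))); first exact: L2_meas.
apply: (eqT1 (inner_norm1 ia)) => z a1.
rewrite /h /h1 /w /conjugation /k0 /bshift !disc_eval0 (quoK theta a1); move: (quo theta alpha z) => qz.
rewrite !(rmorphD, rmorphN, rmorphM, rmorph1) /= !conjCK !circle_conjV.
by field; rewrite circle_neq0.
Qed.

(** Here conj z theta conj chi = h1 + alpha h2, and conj z theta psi is reduced
    with psi = psi(0) + z bshift psi, q = q(0) + z bshift q and
    alpha = alpha(0) + z bshift alpha. *)
Lemma tto_k0t : eqT (A (k0t theta))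
  (fun z => intT psi * intT q * k0t alpha z - intT theta * bshift psi z + h1 z).
Proof.
have [lphi bA _] := sy; have [_ _ prA] := tto_of_weak_symbol ia it adj sy.
have lf : L2 (fun z => (psi z + (chi z)^*) * k0t theta z).
  by have := multiplier_k0t it lphi; congr L2; apply/funext => z; rewrite mulrC.
apply: (is_proj_unique ia lf (prA _ (model_k0t it) lf)).
have mg := model_add ia (model_sub ia (model_scale ia (intT psi * intT q) (model_k0t ia))
  (model_scale ia (intT theta) (model_bshift ia mpsi))) mh1.
pose h z := q z * bshift psi z + intT psi * bshift q z + h2 z.
have hh : H2 h.
  apply: H2_add; last exact: model_H2 mh2.
  apply: H2_add; first by apply: H2_inner => //; exact/H2_bshift/(model_H2 mpsi).
  by apply: H2_scale; exact/H2_bshift/(inner_H2 iq).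
have hk := H2_scale (- (intT theta)^*) (model_H2 mchi).
apply: (is_proj_decomp ia _ mg hh hk); first exact: L2_meas.
apply: (eqT1 (inner_norm1 ia)) => z a1.
rewrite /h /h1 /w /conjugation /k0t /bshift !disc_eval0 theta0E (quoK theta a1).
move: (quo theta alpha z) (intT q) => qz q0.
rewrite !(rmorphD, rmorphN, rmorphM, rmorph1) /= !conjCK !circle_conjV.
by field; rewrite circle_neq0.
Qed.

(** A^* k_0 is the projection of the product of the conjugate symbol with k_0;
    as C_theta commutes with this projection, one may project instead
    conj z theta (psi + conj chi) (1 - alpha(0) conj alpha). *)
Lemma adjoint_k0 : eqT (conjugation theta (As (k0 alpha)))
  (fun z => intT psi * k0t theta z + w z - intT alpha * h2 z
            - intT alpha * bshift (fun z => q z * psi z) z).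
Proof.
set W := fun z => _.
have mqpsi := model_quo_mul ia it iq mpsi.
have mW : model theta W.
  apply: model_sub => //; last by apply: model_scale => //; exact: model_bshift.
  apply: model_sub => //; last by apply: model_scale => //; exact: model_quo_sub mh2.
  by apply: model_add => //; apply: model_scale => //; exact: model_k0t.
have mg := model_conjugation it mW.
have [lphi bA _] := sy.
have lf : L2 (fun z => (psi z + (chi z)^*)^* * k0 alpha z).
  by have := multiplier_k0 ia (L2_conj lphi); congr L2; apply/funext => z; rewrite mulrC.
have hh := H2_scale (- (intT alpha)^*) (model_H2 mm).
suff e : eqT (As (k0 alpha)) (conjugation theta W).
  by apply: (eqT2 e (conjugationK it W)) => z e1 e2; rewrite -e2 /conjugation e1.
have prB := adjoint_proj it adj sy (model_k0 ia) (multiplier_k0 ia).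
apply: (is_proj_unique it lf prB).
apply: (is_proj_decomp it _ mg hh (H2_bshift (model_H2 mpsi))); first exact: L2_meas.
have iqpsi : intT (fun z => q z * psi z) = intT q * intT psi.
  exact: intT_mul (inner_H2 iq) (model_H2 mpsi).
apply: (eqT2 (inner_norm1 ia) (inner_norm1 iq)) => z a1 q1.
rewrite /W /m /h1 /w /k0t /k0 /bshift iqpsi !disc_eval0 theta0E /conjugation (quoK theta a1).
move: (quo theta alpha z) (intT q) q1 => qz q0 q1.
rewrite !(rmorphD, rmorphN, rmorphM, rmorph1) /= !conjCK !circle_conjV (norm1_conj a1) (norm1_conj q1).
by field; rewrite circle_neq0 !norm1_neq0.
Qed.

Lemma intT_k0 : intT (k0 alpha) = (L2norm (k0 alpha) ^+ 2)%:C.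
Proof.
rewrite -(inner_k0 ia (model_k0 ia)) inner_self; congr (_%:C).
by rewrite /L2norm sqr_sqrtr // sqnorm_ge0.
Qed.

Let inner_congrl f f' e : L2 f -> L2 f' -> L2 e -> eqT f f' -> inner f e = inner f' e.
Proof.
by move=> lf lf' le ff'; apply: inner_eq (eqT_refl e) => //; exact: L2_meas.
Qed.

Lemma scalar_k0 : inner (A (k0 theta)) (k0 alpha) =
  intT psi + (intT theta)^* * intT alpha * b0
    + (L2norm (k0 alpha) ^+ 2)%:C * (intT chi)^*.
Proof.
have mg := model_sub ia (model_add ia mpsi (model_scale ia (intT chi)^* (model_k0 ia)))
  (model_scale ia (intT theta)^* model_zh1).
have mA : model alpha (A (k0 theta)).
  by case: sy => _ [hA _ _] _; apply: hA; exact: model_k0.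
have lk := model_L2 (model_k0 ia); have lh := multiplier_id (model_L2 mh1).
have la := H2_L2 (inner_H2 ia).
rewrite (inner_congrl (model_L2 mA) (model_L2 mg) lk tto_k0) (inner_k0 ia mg).
have intT_sub f g : L2 f -> L2 g -> intT (fun z => f z - g z) = intT f - intT g.
  move=> lf lg; rewrite -mulN1r -intT_scale; last exact: L2_L1.
  rewrite -intT_add; [|exact: L2_L1|by apply: L1_scale; exact: L2_L1].
  by congr intT; apply/funext => z; rewrite mulN1r.
rewrite (intT_sub (fun z => psi z + _)); last 2 first.
- by apply: L2_add; [exact: model_L2 mpsi|exact: L2_scale].
- by apply: L2_scale; exact: model_L2 model_zh1.
rewrite intT_add; last 2 first.
- exact: L2_L1 (model_L2 mpsi).
- by apply: L1_scale; exact: L2_L1.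
rewrite intT_scale; last exact: L2_L1.
rewrite intT_scale; last exact: L2_L1 (model_L2 model_zh1).
rewrite (intT_sub (fun z : T => (z : C) * h1 z)) //; last exact: L2_scale.
rewrite intT_scale; last exact: L2_L1.
rewrite (intT_shift (model_H2 mh1)) intT_k0; ring.
Qed.

Lemma scalar_k0t : inner (A (k0t theta)) (k0t alpha) = intT q * intT psi + b0.
Proof.
have m1 := model_k0t ia; have m2 := model_bshift ia mpsi.
have l1 := model_L2 m1; have l2 := model_L2 m2; have l3 := model_L2 mh1.
have m4 := model_scale ia (intT psi * intT q) m1.
have m5 := model_scale ia (intT theta) m2.
have m6 := model_sub ia m4 m5; have mg := model_add ia m6 mh1.
have mA : model alpha (A (k0t theta)).
  by case: sy => _ [hA _ _] _; apply: hA; exact: model_k0t.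
rewrite (inner_congrl (model_L2 mA) (model_L2 mg) l1 tto_k0t).
rewrite (inner_addl (model_L2 m6) l3 l1) (inner_subl (model_L2 m4) (model_L2 m5) l1).
rewrite !inner_scalel // (inner_k0t ia mh1) (inner_k0t ia m2) (inner_k0t ia m1).
rewrite intT_bshift_conjugation //.
have -> : intT (conjugation alpha (k0t alpha)) = intT (k0 alpha).
  apply: intT_eq (conjugation_k0t ia); last exact/L2_meas/(model_L2 (model_k0 ia)).
  by apply: measurable_circle_conjugation => //; exact: L2_meas.
rewrite intT_k0E //.
rewrite theta0E /b0; move: (intT m) => m0; move: (intT q) => q0.
by rewrite !(rmorphD, rmorphN, rmorphM, rmorph1) /= !conjCK; ring.
Qed.

End Compute.
End Kernels.

(** Changing a symbol on a null set does not change the domain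
    condition. *)
Lemma tto_congr (R : realType) (alpha theta : circle R -> R[i]) phi phi' A :
  is_inner alpha -> measurable_circle phi' -> eqT phi phi' ->
  tto theta alpha phi A -> tto theta alpha phi' A.
Proof.
move=> ia mphi' e [lphi bA pr]; split=> //; first exact: L2_eq e lphi.
move=> f mf lf.
have mphif : measurable_circle (fun z => phi z * f z).
  by apply: measurable_circleM; [exact: L2_meas|exact/L2_meas/(model_L2 mf)].
have ef : eqT (fun z => phi z * f z) (fun z => phi' z * f z) by apply: (eqT1 e) => z ->.
have lf' : L2 (fun z => phi z * f z) by exact: L2_eq (eqT_sym ef) lf.
have mA : model alpha (A f) by case: bA => hA _ _; exact: hA.
by apply: (is_proj_congr ia _ _ mA ef (eqT_refl _) (pr f mf lf')) => //; exact: L2_meas.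
Qed.

Theorem theorem8p2 (R : realType) (alpha theta : circle R -> R[i])
  (A As : (circle R -> R[i]) -> (circle R -> R[i]))
  (prescribe_psi : bool) (p a b c : R[i]) (X Y Z : circle R -> R[i]) :
  is_inner alpha -> is_inner theta ->
  nonconstant alpha -> nonconstant theta ->
  divides alpha theta ->
  in_TTO theta alpha A ->
  is_adjoint (model theta) (model alpha) A As ->
  let theta0 := disc_eval theta 0 in
  let alpha0 := disc_eval alpha 0 in
  let q := quo theta alpha in
  let q0 := disc_eval q 0 in
  (if prescribe_psi then a = p else c = p^*) ->
  a + theta0^* * alpha0 * b + (L2norm (k0 alpha) ^+ 2)%:C%C * c
    = inner (A (k0 theta)) (k0 alpha) ->
  q0 * a + b = inner (A (k0t theta)) (k0t alpha) ->
  measurable_circle X -> measurable_circle Y -> measurable_circle Z ->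
  eqT (fun z => X z - theta0^* * Y z)
      (fun z => A (k0 theta) z - c * k0 alpha z - b * theta0^* * alpha z) ->
  eqT (fun z => - theta0 * X z + Y z)
      (fun z => (z : R[i]) * A (k0t theta) z - q0 * a * alpha z) ->
  eqT (fun z => - alpha0 * q z * X z + Y z + (alpha z - alpha0) * Z z)
      (fun z => (z : R[i]) * conjugation theta (As (k0 alpha)) z
                - a * theta z) ->
  let psi := X in
  let chi := fun z => q z * (Z z)^* + theta z * (Y z)^* in
  [/\ tto theta alpha (fun z => psi z + (chi z)^*) A,
      model alpha psi, model theta chi &
      if prescribe_psi then disc_eval psi 0 = p else disc_eval chi 0 = p].

Proof.
move=> ia it na nt iq [phi tphi] adj theta0 alpha0 q q0 ab eq1 eq2 mX mY mZ sX sY sZ psi' chi'.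
have lphi : L2 phi by case: tphi.
have [psi [chi [h [k [mpsi mchi [hh hk] phiE pE]]]]] :=
  symbol_normalised ia it prescribe_psi p na nt lphi.
have lsum : L2 (fun z => psi z + (chi z)^*).
  by apply: L2_add; [exact: model_L2 mpsi|apply: L2_conj; exact: model_L2 mchi].
have sy := weak_symbol_modulo ia it (weak_symbol_of_tto tphi) lsum hh hk phiE.
have [h2 mh2 mh1] := model_decomp ia it iq (model_conjugation it mchi).
pose w := conjugation theta chi.
pose h1 z := w z - alpha z * h2 z; pose b0 := (intT (conjugation alpha h1))^*.
have k0E : eqT (A (k0 theta)) (fun z => psi z + (intT chi)^* * k0 alpha z
    - (intT theta)^* * ((z : R[i]) * h1 z - b0 * alpha z)).
  exact (tto_k0 ia it iq adj mpsi mchi sy mh1 mh2).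
have k0tE' : eqT (A (k0t theta)) (fun z =>
    intT psi * intT q * k0t alpha z - intT theta * bshift psi z + h1 z).
  exact (tto_k0t ia it iq adj mpsi mchi sy mh1 mh2).
have adjE : eqT (conjugation theta (As (k0 alpha))) (fun z =>
    intT psi * k0t theta z + w z - intT alpha * h2 z - intT alpha * bshift (fun z => q z * psi z) z).
  exact (adjoint_k0 ia it iq adj mpsi mchi sy mh1 mh2).
have s1 : inner (A (k0 theta)) (k0 alpha) = intT psi + (intT theta)^* * intT alpha * b0
    + (L2norm (k0 alpha) ^+ 2)%:C * (intT chi)^*.
  exact (scalar_k0 ia it iq adj mpsi mchi sy mh1 mh2).
have s2 : inner (A (k0t theta)) (k0t alpha) = intT q * intT psi + b0.
  exact (scalar_k0t ia it iq adj mpsi mchi sy mh1 mh2).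
have t0E := theta0E ia it iq.
have a1 := one_sub_norm_value ia na; have t1 := one_sub_norm_value it nt.
have th0 : theta0 = intT theta by exact: disc_eval0.
have al0 : alpha0 = intT alpha by exact: disc_eval0.
have q0E : q0 = intT q by exact: disc_eval0.
have n0 : (L2norm (k0 alpha) ^+ 2)%:C != 0 by rewrite -intT_k0 // intT_k0E.
(* Uniqueness for the scalar system: subtracting the equations leaves the
   determinant 1 - |alpha(0)|^2 if a is known and 1 - |theta(0)|^2 if c is. *)
have [aE bE cE] : [/\ a = intT psi, b = b0 & c = (intT chi)^*].
  move: eq1 eq2; rewrite s1 s2 th0 al0 q0E => eq1 eq2.
  case: (prescribe_psi) ab pE => ab pE.
    have aE : a = intT psi by rewrite ab pE.
    have bE : b = b0 by move: eq2; rewrite aE => /addrI.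
    by split=> //; move: eq1; rewrite aE bE => /addrI/(mulfI n0).
  have cE : c = (intT chi)^* by rewrite ab pE.
  have bE : b = intT q * (intT psi - a) + b0.
    by apply: (addrI (intT q * a)); rewrite eq2; ring.
  have aE : a = intT psi.
    move: eq1; rewrite cE => /addIr; rewrite bE => eq1.
    apply/eqP; rewrite -subr_eq0 -(mulrI_eq0 _ (mulfI t1)); apply/eqP.
    transitivity ((a + (intT theta)^* * intT alpha * (intT q * (intT psi - a) + b0))
      - (intT psi + (intT theta)^* * intT alpha * b0)); last by rewrite eq1 subrr.
    rewrite t0E; ring.
  by split=> //; rewrite bE aE subrr mulr0 add0r.
have eX : eqT (fun z => X z - theta0^* * Y z)
    (fun z => psi z - theta0^* * ((z : R[i]) * h1 z)).
  by apply: (eqT2 sX k0E) => z -> ->; rewrite bE cE th0; ring.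
have eY : eqT (fun z => - theta0 * X z + Y z) (fun z => - theta0 * psi z + (z : R[i]) * h1 z).
  apply: (eqT2 sY k0tE') => z -> ->; rewrite aE th0 q0E /k0t /bshift disc_eval0 t0E circle_conjV.
  by field; rewrite circle_neq0.
(* The first two equations form a linear system with determinant
   1 - |theta(0)|^2. *)
have XE : eqT X psi.
  apply: (eqT2 eX eY) => z e1 e2.
  apply/eqP; rewrite -subr_eq0 -(mulrI_eq0 _ (mulfI t1)) -th0; apply/eqP.
  transitivity ((X z - theta0^* * Y z) - (psi z - theta0^* * ((z : R[i]) * h1 z))
    + theta0^* * ((- theta0 * X z + Y z) - (- theta0 * psi z + (z : R[i]) * h1 z))).
    by ring.
  by rewrite e1 e2 !subrr mulr0 addr0.
have YE : eqT Y (fun z => (z : R[i]) * h1 z).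
  by apply: (eqT2 eY XE) => z + e; rewrite e => /addrI.
have iqpsi : intT (fun z => q z * psi z) = intT q * intT psi.
  exact: intT_mul (inner_H2 iq) (model_H2 mpsi).
have eZ : eqT (fun z => - alpha0 * q z * X z + Y z + (alpha z - alpha0) * Z z)
    (fun z => - alpha0 * q z * psi z + (z : R[i]) * h1 z + (alpha z - alpha0) * ((z : R[i]) * h2 z)).
  apply: (eqT2 sZ adjE) => z -> ->.
  rewrite aE al0 /h1 /k0t /bshift iqpsi disc_eval0 circle_conjV.
  have -> : intT theta = intT q * intT alpha by [].
  move: (w z) (q z) (intT q) => wz qz qq.
  by field; rewrite circle_neq0.
have ZE' : eqT (fun z => (alpha z - alpha0) * Z z) (fun z => (alpha z - alpha0) * ((z : R[i]) * h2 z)).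
  by apply: (eqT3 eZ XE YE) => z + e e'; rewrite e e' => /addrI.
have ZE : eqT Z (fun z => (z : R[i]) * h2 z).
  apply: (eqT2 ZE' (inner_norm1 ia)) => z + u1; apply: mulfI; rewrite subr_eq0.
  apply/negP => /eqP e; move: a1; rewrite -al0 -e mulrC -normCK u1 expr1n subrr.
  by rewrite eqxx.
have chiE : eqT chi chi'.
  (* chi = C_theta (C_theta chi) = theta conj (z (h1 + alpha h2)). *)
  have e0 : eqT chi (fun z => q z * ((z : R[i]) * h2 z)^* + theta z * ((z : R[i]) * h1 z)^*).
    apply: (eqT2 (inner_norm1 ia) (inner_norm1 iq)) => z u1 v1.
    rewrite /h1 /w /conjugation (quoK theta u1) -/q; have {}v1 : `|q z| = 1 := v1.
    move: (q z) v1 => qz v1.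
    rewrite !(rmorphD, rmorphN, rmorphM) /= !conjCK circle_conjV (norm1_conj u1) (norm1_conj v1).
    by field; rewrite circle_neq0 !norm1_neq0.
  by apply: (eqT3 e0 YE ZE) => z -> ey ez; rewrite /chi' ey ez.
have mchi' : measurable_circle chi'.
  have mq := H2_meas (inner_H2 iq); have mt := H2_meas (inner_H2 it).
  by apply: measurable_circleD; apply: measurable_circleM => //; exact: measurable_circle_conj.
split.
- apply: (tto_congr (phi := fun z => psi z + (chi z)^*) ia).
  + by apply: measurable_circleD => //; exact: measurable_circle_conj.
  + by apply: (eqT2 XE chiE) => z Xz cz; rewrite /psi' Xz cz.
  + exact: (tto_of_weak_symbol ia it adj sy).
- exact: (model_eq ia mX (eqT_sym XE) mpsi).
- exact: (model_eq it mchi' chiE mchi).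
rewrite !disc_eval0; case: (prescribe_psi) pE => <-; apply: intT_eq => //.
- exact/L2_meas/(model_L2 mpsi).
- exact/L2_meas/(model_L2 mchi).
- exact: eqT_sym.
Qed.
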